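(* Let $r\geqslant 2$ be any fixed integer and $(k,\ell)$ be an exponent pair satisfying $1-\ell>k(r-1)$. For any $\varepsilon>0$ and $x$ sufficiently large, $$\sum_{n \leqslant x} \tau_r\left(\left\lfloor \frac{x}{n}\right\rfloor\right) = x\sum_{n=1}^\infty \frac{\tau_r(n)}{n(n+1)} + O_{\varepsilon,r}\left(x^{\frac{k(r-1)+\ell+r-1}{k(r-1)+\ell+2r-1}+\varepsilon}\right).$$
   Context: $\tau_r$ is the Dirichlet-Piltz divisor function: $\tau_1=\mathbf 1$ (the constant function $1$) and $\tau_r=\tau_{r-1}\star\mathbf 1$ for $r\geqslant 2$, where $(f\star g)(n)=\sum_{d\mid n}f(d)g(n/d)$. $\lfloor\cdot\rfloor$ is the integer part; $e(t)=e^{2i\pi t}$. The pair $(k,\ell)$ is fixed, so implied constants may depend on it. Exponent pair: a pair $(k,\ell)$ of real numbers with $0\leqslant k\leqslant \frac12\leqslant \ell\leqslant 1$ is an exponent pair if for all real $1\leqslant R<R_1\leqslant 2R$, all $T>0$ and all positive-valued $F\in C^\infty[R,2R]$ with $|F^{(j)}(t)|\asymp TR^{-j}$ for all integers $j\geqslant 0$ and all $t\in[R,2R]$, one has $\sum_{R<n\leqslant R_1}e(F(n))\ll T^kR^{\ell-k}+RT^{-1}$, the implied constant depending only on $k,\ell$ and on the constants implied in the conditions on $F^{(j)}$ (which may depend on $j$). *)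

(* Defs.v *)
From HB Require Import structures.
From mathcomp Require Import all_boot all_order all_algebra.
From mathcomp Require Import all_classical all_reals all_analysis.
From mathcomp Require Import complex.

Set Implicit Arguments.
Unset Strict Implicit.
Unset Printing Implicit Defensive.

Import Order.TTheory GRing.Theory Num.Theory.
Import numFieldNormedType.Exports.

Local Open Scope classical_set_scope.
Local Open Scope ring_scope.
Local Open Scope complex_scope.

Definition dirichlet_conv (f g : nat -> nat) (n : nat) : nat :=
  (\sum_(d <- divisors n) f d * g (n %/ d))%N.

(* Only r >= 1 is meaningful: tau 0 is the junk value tau 1. *)
Definition tau (r : nat) : nat -> nat :=
  iter r.-1 (fun f => dirichlet_conv f (fun=> 1%N)) (fun=> 1%N).

Definition e (R : realType) (t : R) : R[i] :=
  cos (2 * pi * t) +i* sin (2 * pi * t).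

(* Derivative relative to the set A, hence one-sided at the endpoints when A
   is a closed interval. *)
Definition has_deriv_within (R : realType) (A : set R) (f : R -> R) (t l : R)
  : Prop :=
  (f y - f t) / (y - t) @[y --> within A t^'] --> l.

(* f is C^oo on A, with G j as its j-th derivative there; when A is a
   nondegenerate interval, G is determined on A by f. *)
Definition smooth_derivs (R : realType) (A : set R) (f : R -> R)
    (G : nat -> R -> R) : Prop :=
  (forall t, A t -> G 0%N t = f t) /\
  forall j t, A t -> has_deriv_within A (G j) t (G j.+1 t).

(* c j and C j are the constants implied in |F^(j)| \asymp T A^-j; the bound
   K depends on them (and on k, l) only. For 0 <= A, the integers n with
   A < n <= B are those with truncn A < n <= truncn B. *)
Definition exponent_pair (R : realType) (k l : R) : Prop :=
  [/\ 0 <= k, k <= 1 / 2, 1 / 2 <= l, l <= 1 &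
  forall c C : nat -> R, (forall j, 0 < c j) -> (forall j, 0 < C j) ->
  exists K : R, forall (A B T : R) (F : R -> R) (G : nat -> R -> R),
    1 <= A -> A < B -> B <= 2 * A -> 0 < T ->
    (forall t, t \in `[A, 2 * A] -> 0 < F t) ->
    smooth_derivs `[A, 2 * A] F G ->
    (forall j t, t \in `[A, 2 * A] ->
       c j * (T * A ^- j) <= `|G j t| <= C j * (T * A ^- j)) ->
    `| \sum_((Num.truncn A).+1 <= n < (Num.truncn B).+1) e (F n%:R) |
      <= (K * (T `^ k * A `^ (l - k) + A / T))%:C].

(* Main.v *)
Require Import Defs.
From mathcomp Require Import all_boot all_order all_algebra.
From mathcomp Require Import all_classical all_reals all_analysis.
From mathcomp Require Import complex.
From mathcomp Require Import ring lra zify.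

Import Order.TTheory GRing.Theory Num.Theory.
Import numFieldNormedType.Exports.

Local Open Scope ring_scope.

(** The proof bounds the sum by splitting according to the value [d] of
    [floor (x / n)] and by estimating sums of [tau r d] against the sawtooth
    [psi(y) = {y} - 1/2] at [y = x / d] and [y = x / (d + 1)].

    Write [theta] for the exponent of the theorem and put [Q = x ^ (1 - theta)]. The
    integers [n <= x / (Q + 1)], about [x ^ theta] of them, are treated trivially with
    [tau r m << m ^ eps] ([tau_bound]). The others are those with
    [d = floor (x / n) <= Q], and for each such [d] there are
    [floor (x / d) - floor (x / (d + 1))] of them ([sum_floor_quotients]). Writing each
    floor as [y - 1/2 - psi(y)] produces the main term, completed to the infinite
    series at a cost of [x * Q ^ (eps - 1)] ([series_tail]), and the two sawtooth sums,
    which are cut into dyadic blocks [D < d <= D'], [D' <= 2 D].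

    In a block the sawtooth is compared with its averages over short windows of length
    [1 / H] ([sawtooth_sum]). Since it only jumps downwards, one-sided averages
    bound it from both sides up to [1 / H], and the averages, being divided
    differences of a second Bernoulli polynomial, have Fourier coefficients
    of size at most [min (1 / h, H / h ^ 2)], up to a constant. What is needed are
    therefore the sums of [tau r d * e (h x / (d + delta))] over the block, for all
    frequencies [h].

    For those ([tau_exp_sum]), write [d] as a product of [r] factors. One factor is
    larger than [D ^ (1/r)]; when the product [m] of the others is fixed, it runs over an
    interval ([tau_dissection]) and the phase is [h x / (m n + delta)], to which the
    exponent pair applies with [T] about [h x / D] and length [D / m]
    ([exponent_pair_recip]). Summing over [m <= 2 D ^ (1 - 1/r)] gives
    [h ^ k * (x ^ k * D ^ (1 - k - (1 - l + k) / r) + D ^ 2 / x)], up to [x ^ eps].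

    Summation over [h] turns this into the same expression with [h] replaced by [H]. With
    [H = x ^ (1 - 2 theta)] and [D <= Q], the truncation error [D / H] is at most
    [x ^ theta], and so is the contribution of the exponential sums: [theta] is the
    solution of the linear equation that makes both equal at [D = Q]
    ([theta_facts], [power_balance]). *)

(** * The divisor function is smaller than any power *)

Lemma tau1 n : tau 1 n = 1%N.
Proof. by []. Qed.

Lemma tauS r n : (1 <= r)%N ->
  tau r.+1 n = (\sum_(d <- divisors n) tau r d)%N.
Proof.
case: r => // r _; rewrite /tau /= /dirichlet_conv.
by apply: eq_bigr => d _; rewrite muln1.
Qed.

(** A divisor of [n] is determined by its [p]-part, a power of [p] with exponent at most
    that of [n], and by its part prime to [p]. *)
Lemma size_divisors_part p n : (0 < n)%N ->
  (size (divisors n) <= (logn p n).+1 * size (divisors n`_p^'))%N.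
Proof.
move=> n0.
have -> : ((logn p n).+1 * size (divisors n`_p^'))%N
   = size [seq (p ^ i * d)%N | i <- iota 0 (logn p n).+1, d <- divisors n`_p^'].
  by rewrite size_allpairs size_iota.
apply: uniq_leq_size => [|d]; first exact: divisors_uniq.
rewrite -dvdn_divisors // => dn.
have d0 : (0 < d)%N by apply: dvdn_gt0 dn.
apply/allpairsP; exists (logn p d, (d`_p^')%N); split.
- by rewrite (mem_iota 0) add0n ltnS; apply: dvdn_leq_log.
- by rewrite -dvdn_divisors ?part_gt0 //; apply: partn_dvd.
- by rewrite -p_part partnC.
Qed.

Lemma count_primes_part (a : pred nat) p n : p \in primes n ->
  (a p + count a (primes n`_p^') = count a (primes n))%N.
Proof.
move=> pn.
have -> : primes n`_p^' = rem p (primes n).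
  rewrite primes_part rem_filter ?primes_uniq //.
by rewrite (permP (perm_to_rem pn)).
Qed.

Lemma count_primes_le P0 n : (count (fun p => p < P0)%N (primes n) <= P0)%N.
Proof.
rewrite -size_filter -[leqRHS](size_iota 0).
apply: uniq_leq_size => [|p]; first by rewrite filter_uniq ?primes_uniq.
by rewrite mem_filter mem_iota => /andP[].
Qed.

(** Splitting off one prime power [p ^ a] multiplies the number of divisors by [a + 1] and
    [n ^ eps] by [p ^ (a * eps)]. If [p >= 2 ^ (1 / eps)] the first factor is at most [2 ^ a],
    hence at most the second; for the boundedly many smaller primes it exceeds
    the second by a bounded factor [K] only. *)
Lemma divisor_bound (R : realType) (eps : R) : 0 < eps ->
  exists2 C : R, 1 <= C & forall n, (0 < n)%N ->
    (size (divisors n))%:R <= C * n%:R `^ eps.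
Proof.
move=> e0.
have l2 : 0 < ln (2 : R) by apply: ln_gt0; lra.
pose K : R := 1 + (eps * ln 2)^-1.
have el2 : 0 < eps * ln (2 : R) by apply: mulr_gt0.
have K1 : 1 <= K by rewrite lerDl invr_ge0 ltW.
pose P0 := (Num.truncn ((2 : R) `^ eps^-1)).+1.
have HP0 p : (P0 <= p)%N -> 2 <= (p%:R : R) `^ eps.
  move=> hp.
  have h : (2 : R) `^ eps^-1 <= p%:R.
    apply: ltW; apply: (lt_le_trans (truncnS_gt _)).
    by rewrite ler_nat.
  have := @ge0_ler_powR R eps (ltW e0) _ _ _ _ h.
  rewrite -powRrM mulVf ?gt_eqF // powRr1 //; apply.
    by rewrite nnegrE powR_ge0.
  by rewrite nnegrE.
have HK (a p : nat) : (1 < p)%N -> a.+1%:R <= K * (p%:R ^+ a) `^ eps.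
  move=> p1.
  have : a.+1%:R <= K * ((2 : R) ^+ a) `^ eps.
    have -> : ((2 : R) ^+ a) `^ eps = expR (a%:R * (eps * ln 2)).
      rewrite -powR_mulrn // -powRrM /powR ifF; last by apply/negbTE; rewrite pnatr_eq0.
      by congr expR; ring.
    apply: (le_trans (y := K * (1 + a%:R * (eps * ln 2)))).
      have -> : K * (1 + a%:R * (eps * ln 2))
          = 1 + a%:R + a%:R * (eps * ln 2) + (eps * ln 2)^-1.
        by rewrite /K; field; rewrite !gt_eqF.
      rewrite -natr1.
      have : 0 <= a%:R * (eps * ln (2 : R)) by apply: mulr_ge0 => //; apply: ltW.
      have : 0 <= (eps * ln (2 : R))^-1 by rewrite invr_ge0 ltW.
      lra.
    by apply: ler_wpM2l; [lra|exact: expR_ge1Dx].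
  move/le_trans; apply; apply: ler_wpM2l; first by lra.
  apply: ge0_ler_powR; rewrite ?nnegrE ?exprn_ge0 //; first exact: ltW.
  by apply: lerXn2r; rewrite ?nnegrE // ler_nat.
have HK2 (a p : nat) : (P0 <= p)%N -> a.+1%:R <= (p%:R ^+ a : R) `^ eps.
  move=> hp; rewrite -powR_mulrn // -powRrM mulrC powRrM powR_mulrn ?powR_ge0 //.
  apply: (le_trans (y := 2 ^+ a)).
    by rewrite -natrX ler_nat ltn_expl.
  by apply: lerXn2r; rewrite ?nnegrE ?powR_ge0 // HP0.
exists (K ^+ P0); first exact: exprn_ege1.
(* The exponent of K counts the small primes that have been used up. *)
suff main n : (0 < n)%N -> (size (divisors n))%:R
    <= K ^+ count (fun p => p < P0)%N (primes n) * n%:R `^ eps.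
  move=> n n0; apply: (le_trans (main n n0)); apply: ler_wpM2r; first exact: powR_ge0.
  by apply: ler_weXn2l => //; exact: count_primes_le.
elim/ltn_ind: n => n IH n0.
have [n1|n1] := leqP n 1.
  have -> : n = 1%N by apply/eqP; rewrite eqn_leq n1 n0.
  by rewrite /= expr0 mul1r powR1.
set p := pdiv n.
have pp : prime p by apply: pdiv_prime.
have pn : (p %| n)%N by apply: pdiv_dvd.
have pin : p \in primes n by rewrite mem_primes pp n0 pn.
set m := (n`_p^')%N.
have nE : n = (p ^ logn p n * m)%N by rewrite -p_part partnC.
have m0 : (0 < m)%N by apply: part_gt0.
have mn : (m < n)%N.
  rewrite [ltnRHS]nE -[ltnLHS]mul1n ltn_pmul2r //.
  rewrite -[1%N](expn0 p) ltn_exp2l ?prime_gt1 //.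
  by rewrite logn_gt0.
have -> : (n%:R : R) `^ eps = (p%:R ^+ logn p n) `^ eps * m%:R `^ eps.
  by rewrite -powRM ?exprn_ge0 // -natrX -natrM -nE.
have IHm := IH m mn m0.
have : ((size (divisors n))%:R : R) <= (logn p n).+1%:R * (size (divisors m))%:R.
  by rewrite -natrM ler_nat; exact: size_divisors_part.
move=> h; apply: (le_trans h).
rewrite -(count_primes_part _ p n pin) exprD -/m.
have [hp|hp] := leqP P0 p.
  rewrite expr0 mul1r mulrCA.
  by apply: ler_pM => //; apply: HK2.
rewrite expr1 mulrACA.
by apply: ler_pM => //; apply: HK; exact: prime_gt1.
Qed.

Lemma tau_bound (R : realType) (r : nat) (eps : R) : (1 <= r)%N -> 0 < eps ->
  exists2 C : R, 1 <= C & forall n, (0 < n)%N ->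
    (tau r n)%:R <= C * n%:R `^ eps.
Proof.
elim: r eps => // r IH eps _ e0.
have [->|r0] := eqVneq r 0%N.
  exists 1 => // n n0; rewrite mul1r tau1.
  by rewrite -[leLHS](powRr0 (n%:R : R)); apply: ler_powR; rewrite ?ler1n // ltW.
have r1 : (1 <= r)%N by rewrite lt0n.
have e2 : 0 < eps / 2 by lra.
have [C1 C11 H1] := IH _ r1 e2.
have [C2 C21 H2] := divisor_bound R _ e2.
exists (C1 * C2); first by rewrite -[1]mulr1; apply: ler_pM.
move=> n n0; rewrite tauS // natr_sum.
apply: (@le_trans _ _ (\sum_(d <- divisors n) C1 * n%:R `^ (eps / 2))).
  rewrite !big_seq; apply: ler_sum => d; rewrite -dvdn_divisors // => dn.
  apply: (le_trans (H1 d (dvdn_gt0 n0 dn))).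
  apply: ler_wpM2l; first by lra.
  have dle : (d%:R : R) <= n%:R by rewrite ler_nat; apply: dvdn_leq.
  by apply: (ge0_ler_powR _ _ _ dle); rewrite ?nnegrE ?ler0n ?(ltW e2).
rewrite big_const_seq count_predT iter_addr_0 -[_ *+ size _]mulr_natr.
have -> : C1 * C2 * n%:R `^ eps = (C1 * n%:R `^ (eps / 2)) * (C2 * n%:R `^ (eps / 2)).
  rewrite mulrACA -powRD -?splitr //.
  by apply/implyP => _; rewrite pnatr_eq0 -lt0n.
by apply: ler_wpM2l; [apply: mulr_ge0; [lra|exact: powR_ge0]|exact: H2].
Qed.

(** * Dissecting the divisor function along a long factor *)

Lemma sum_divisors (V : nmodType) (F : nat -> V) d X : (0 < d <= X)%N ->
  \sum_(c <- divisors d) F c = \sum_(1 <= c < X.+1 | (c %| d)%N) F c.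
Proof.
move=> /andP[d0 dX]; rewrite -[RHS]big_filter; apply: perm_big.
apply: uniq_perm; rewrite ?divisors_uniq ?filter_uniq ?iota_uniq // => c.
rewrite mem_filter mem_index_iota ltnS -dvdn_divisors //.
have [cd|//] := boolP (c %| d)%N.
by rewrite (dvdn_gt0 d0 cd) (leq_trans (dvdn_leq d0 cd) dX).
Qed.

Lemma sum_multiples (V : nmodType) (F : nat -> V) c X : (0 < c)%N ->
  \sum_(1 <= d < X.+1 | (c %| d)%N) F d
  = \sum_(1 <= n < X.+1 | (c * n <= X)%N) F (c * n)%N.
Proof.
move=> c0; rewrite -[LHS]big_filter -[RHS]big_filter -(big_map (muln c) predT F).
apply: perm_big; apply: uniq_perm.
- by rewrite filter_uniq ?iota_uniq.
- rewrite map_inj_uniq ?filter_uniq ?iota_uniq // => a b /eqP.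
  by rewrite eqn_pmul2l // => /eqP.
move=> d; rewrite mem_filter mem_index_iota ltnS.
apply/andP/mapP => [[/dvdnP[n ->] /andP[n0 nX]]|[n]].
- exists n; last by rewrite mulnC.
  rewrite mem_filter mem_index_iota ltnS mulnC nX /=.
  rewrite muln_gt0 in n0; case/andP: n0 => -> _ /=.
  by apply: leq_trans nX; rewrite leq_pmulr.
- rewrite mem_filter mem_index_iota => /andP[h /andP[n1 _]] ->.
  by rewrite dvdn_mulr // h muln_gt0 c0 n1.
Qed.

(** The definition of [tau j.+1] as a Dirichlet convolution, read on weighted
    sums: [d = c * n] turns a sum over [d] into a double sum in which [n] carries
    no arithmetic weight. *)
Lemma sum_tauS (R : realType) j X (G : nat -> R) : (1 <= j)%N ->
  (forall d, (X < d)%N -> G d = 0) ->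
  \sum_(1 <= d < X.+1) (tau j.+1 d)%:R * G d
  = \sum_(1 <= n < X.+1) \sum_(1 <= c < X.+1) (tau j c)%:R * G (c * n)%N.
Proof.
move=> j1 G0; transitivity (\sum_(1 <= d < X.+1) \sum_(1 <= c < X.+1 | (c %| d)%N)
    (tau j c)%:R * G d).
  apply: eq_big_nat => d /andP[d0 dX].
  by rewrite tauS // natr_sum mulr_suml; apply: sum_divisors; rewrite d0.
rewrite (exchange_big_dep_nat predT) //= [RHS](exchange_big_dep_nat predT) //=.
apply: eq_big_nat => c /andP[c0 _].
rewrite (sum_multiples _ (fun d => (tau j c)%:R * G d)) // big_mkcond.
by apply: eq_bigr => n _; case: leqP => // h; rewrite G0 ?mulr0.
Qed.

Lemma leq_tauS j c : (1 <= j)%N -> (0 < c)%N -> (tau j c <= tau j.+1 c)%N.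
Proof.
move=> j1 c0; rewrite tauS // (bigD1_seq c) ?divisors_uniq ?divisors_id //=.
exact: leq_addr.
Qed.

(** A dissection of [tau j] adapted to one-variable estimates. In
    [d = n_1 * ... * n_j] with [Y ^ j <= d], some factor exceeds [Y]. Single out the
    last such factor: it runs over an interval once the product [m] of the
    others is given, which costs [beta (q * m)], and there are at most
    [j * tau j m] ways to reach a given [m]. The multiplier [q] carries
    the small factors already split off, so that the induction on [j] closes. *)
Lemma tau_dissection (R : realType) (g beta : nat -> R) D D' Y :
  (forall M, (0 < M)%N ->
    `|\sum_(1 <= n < D'.+1 | (D < M * n <= D')%N && (Y < n)%N) g (M * n)%N|
      <= beta M) ->
  forall j q, (1 <= j)%N -> (0 < q)%N -> (q * Y ^ j <= D)%N ->
  `|\sum_(1 <= d < D'.+1 | (D < q * d <= D')%N) (tau j d)%:R * g (q * d)%N|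
  <= j%:R * \sum_(1 <= m < D'.+1 | (q * m * Y.+1 <= D')%N)
              (tau j m)%:R * beta (q * m)%N.
Proof.
move=> Hb.
have beta0 M : (0 < M)%N -> 0 <= beta M by move/Hb; apply: le_trans.
pose G q d := if (D < q * d <= D')%N then g (q * d)%N else 0.
pose B q m := if (q * m * Y.+1 <= D')%N then beta (q * m)%N else 0.
have HG q M : (0 < q)%N -> (0 < M)%N ->
    `|\sum_(1 <= n < D'.+1 | (Y < n)%N) G q (M * n)%N| <= B q M.
  move=> q0 M0; rewrite /B; case: leqP => h.
    have := Hb (q * M)%N; rewrite muln_gt0 q0 M0 => /(_ isT); congr (`|_| <= _).
    rewrite [LHS]big_mkcond [RHS]big_mkcond; apply: eq_bigr => n _.
    by rewrite /G mulnA andbC; case: (Y < n)%N.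
  rewrite big1 ?normr0 // => n Yn; rewrite /G mulnA ifF //.
  apply/negbTE; rewrite negb_and -!ltnNge; apply/orP; right.
  by apply: (leq_trans h); rewrite leq_pmul2l // muln_gt0 q0.
have B0 q m : (0 < q)%N -> (0 < m)%N -> 0 <= B q m.
  by move=> q0 m0; rewrite /B; case: ifP => // _; apply: beta0; rewrite muln_gt0 q0.
suff main j q : (1 <= j)%N -> (0 < q)%N -> (q * Y ^ j <= D)%N ->
    `|\sum_(1 <= d < D'.+1) (tau j d)%:R * G q d|
    <= j%:R * \sum_(1 <= m < D'.+1) (tau j m)%:R * B q m.
  move=> i p i1 p0 pY; have := main i p i1 p0 pY.
  congr (`|_| <= _ * _); rewrite [RHS]big_mkcond; apply: eq_bigr => d _.
    by rewrite /G; case: ifP => //; rewrite mulr0.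
  by rewrite /B; case: ifP => //; rewrite mulr0.
elim: j q => // j IH q _ q0 qY.
have [j0|j0] := eqVneq j 0%N.
  move: qY; rewrite {IH}j0 expn1 mul1r => qY.
  have -> : \sum_(1 <= d < D'.+1) (tau 1 d)%:R * G q d
      = \sum_(1 <= n < D'.+1 | (Y < n)%N) G q (1 * n)%N.
    rewrite [RHS]big_mkcond; apply: eq_bigr => d _; rewrite tau1 mul1r mul1n.
    case: (ltnP Y d) => // dY; rewrite /G ifF //.
    apply/negbTE; rewrite negb_and -!leqNgt (leq_trans _ qY) //.
    by rewrite leq_pmul2l.
  apply: (le_trans (HG q 1%N q0 isT)).
  have [D0|D0] := posnP D'.
    have -> : B q 1%N = 0 by rewrite /B D0 muln1 leqn0 muln_eq0 orbF -leqn0 leqNgt q0.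
    by rewrite big_nat sumr_ge0 // => m /andP[m0 _]; rewrite mulr_ge0 ?B0.
  rewrite big_ltn // tau1 mul1r lerDl big_nat sumr_ge0 // => m /andP[m0 _].
  by rewrite mulr_ge0 ?B0 // (ltn_trans _ m0).
have j1 : (1 <= j)%N by rewrite lt0n.
rewrite (sum_tauS R j D' (G q)) //; last first.
  move=> d Dd; rewrite /G ifF //; apply/negbTE; rewrite negb_and -!ltnNge.
  by apply/orP; right; apply: (leq_trans Dd); rewrite leq_pmull.
rewrite (bigID (leq^~ Y)) /= -natr1 mulrDl mul1r.
apply: (le_trans (ler_normD _ _)); apply: lerD; last first.
  under eq_bigl do rewrite -ltnNge.
  rewrite (exchange_big_dep_nat predT) //=.
  apply: (le_trans (ler_norm_sum _ _ _)).
  rewrite !big_nat; apply: ler_sum => c /andP[c0 _].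
  under eq_bigl do rewrite andbT.
  rewrite -mulr_sumr normrM ger0_norm //.
  by apply: ler_pM => //; [rewrite ler_nat leq_tauS|exact: HG].
rewrite (sum_tauS R j D' (B q)) //; last first.
  move=> d Dd; rewrite /B ifF //; apply/negbTE; rewrite -ltnNge.
  by apply: (leq_trans Dd); rewrite -mulnA mulnCA leq_pmulr // muln_gt0 q0.
rewrite mulr_sumr.
apply: (le_trans (ler_norm_sum _ _ _)).
rewrite big_mkcond /= !big_nat; apply: ler_sum => n /andP[n0 _].
case: (leqP n Y) => nY; last first.
  by rewrite mulr_ge0 // big_nat sumr_ge0 // => m /andP[m0 _]; rewrite mulr_ge0 ?B0 // muln_gt0 m0.
have := IH (q * n)%N j1; rewrite muln_gt0 q0 n0 => /(_ isT).
have hY : (q * n * Y ^ j <= D)%N.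
  by apply: leq_trans qY; rewrite -mulnA leq_pmul2l // expnS leq_mul2r nY orbT.
move=> /(_ hY); congr (`|_| <= _ * _); apply: eq_bigr => c _.
  by rewrite /G -mulnA (mulnC n).
by rewrite /B -(mulnA q) (mulnC n).
Qed.

(** * A discrete Fourier expansion of the second Bernoulli polynomial *)

Lemma dist_cos (R : realType) (a b : R) : `|cos a - cos b| <= `|a - b|.
Proof.
wlog ab : a b / b <= a.
  move=> H; have [/H//|/ltW/H] := leP b a.
  by rewrite distrC [X in _ <= X]distrC.
have [c _ ->] := MVT_segment ab (fun x _ => is_derive_cos x)
  (continuous_subspaceT (@continuous_cos R)).
by rewrite normrM normrN ler_piMl // ler_norml sin_geN1 sin_le1.
Qed.

Lemma dist_sin (R : realType) (a b : R) : `|sin a - sin b| <= `|a - b|.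
Proof.
rewrite -!cosBpihalf; apply: (le_trans (dist_cos _ _ _)).
by rewrite opprB addrA subrK.
Qed.

(** Put [u = 2 v]. As [sin v >= v cos v],
    [sin (2 v) = 2 sin v cos v >= 2 v (cos v) ^ 2 = v (1 + cos (2 v))]. *)
Lemma sin_ge_half (R : realType) (u : R) : 0 <= u -> u <= pi / 2 -> u / 2 <= sin u.
Proof.
move=> u0 u1; set v := u / 2.
have v0 : 0 <= v by rewrite /v; lra.
have pi0 := pi_gt0 R.
have hs : v * cos v <= sin v.
  have [c] := MVT_segment v0 (fun x _ => is_derive_sin x)
    (continuous_subspaceT (@continuous_sin R)).
  rewrite in_itv /= sin0 !subr0 mulrC => /andP[c0 cv] ->.
  apply: ler_wpM2l => //.
  rewrite leNgt ltr_cos ?in_itv /= -?leNgt //; rewrite ?c0 ?v0 /=; move: cv; rewrite /v; lra.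
have c0 : 0 <= cos v.
  by apply: cos_ge0_pihalf; apply/andP; split; move: v0; rewrite /v; lra.
have c2 : 0 <= cos (v *+ 2).
  by apply: cos_ge0_pihalf; apply/andP; split; rewrite /v; lra.
have -> : u = v *+ 2 by rewrite /v; lra.
rewrite sin_mulr2n; move: c2; rewrite cos_mulr2n => c2.
have := ler_wpM2l c0 hs; have := mulr_ge0 v0 c2.
rewrite !expr2; nra.
Qed.

Lemma sin_pin (R : realType) (n : nat) : sin (n%:R * pi : R) = 0.
Proof.
elim: n => [|n IH]; first by rewrite mul0r sin0.
by rewrite -natr1 mulrDl mul1r sinDpi IH oppr0.
Qed.

Lemma cos_2pin (R : realType) (x : R) (n : nat) : cos (x + 2 * pi * n%:R) = cos x.
Proof.
elim: n => [|n IH]; first by rewrite mulr0 addr0.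
have -> : x + 2 * pi * n.+1%:R = x + 2 * pi * n%:R + pi *+ 2.
  by rewrite -[n.+1%:R]natr1; ring.
by rewrite cosD2pi.
Qed.

(** The Dirichlet kernel, with the denominator cleared. *)
Lemma sum_cos_dirichlet (R : realType) (x : R) (L : nat) :
  2 * sin x * \sum_(1 <= h < L.+1) cos (2 * h%:R * x)
  = sin ((2 * L + 1)%:R * x) - sin x.
Proof.
elim: L => [|L IH]; first by rewrite big_nil mulr0 mul1r subrr.
rewrite big_nat_recr //= mulrDr IH.
have -> : (2 * L.+1 + 1)%:R * x = 2 * L.+1%:R * x + x by rewrite natrD natrM mulrDl mul1r.
have -> : (2 * L + 1)%:R * x = 2 * L.+1%:R * x - x.
  by rewrite -[L.+1%:R]natr1 natrD natrM; ring.
by rewrite sinB sinD; ring.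
Qed.

(** The squared sine of [pi * h / M] is minus a quarter of the eigenvalue of the second
    difference operator on Z/M at the frequency [h]; so this is the expansion of its
    Green function, a discrete form of the Fourier series of the second Bernoulli
    polynomial. Both sides have second difference [-2] at each [0 < j < M] (on the right by the
    Dirichlet kernel), and they agree at [j = 0] and [j = 1]. *)
Lemma green_cos (R : realType) (L j : nat) : (j <= 2 * L + 1)%N ->
  let M : R := (2 * L + 1)%:R in
  \sum_(1 <= h < L.+1) (sin (h%:R * pi / M)) ^- 2
     * (1 - cos (2 * pi * (h%:R * j%:R / M)))
  = j%:R * (M - j%:R).
Proof.
move=> jL M.
have M0 : 0 < M by rewrite ltr0n addn1.
have pi0 := pi_gt0 R.
have sn0 i : (0 < i < 2 * L + 1)%N -> sin (i%:R * pi / M) != 0.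
  move=> /andP[i0 iL]; rewrite gt_eqF //; apply: sin_gt0_pi; apply/andP; split.
    by apply: divr_gt0 => //; apply: mulr_gt0 => //; rewrite ltr0n.
  by rewrite ltr_pdivrMr // mulrC ltr_pM2l // /M ltr_nat.
have s0 h : (1 <= h < L.+1)%N -> sin (h%:R * pi / M) != 0.
  by move=> hL; apply: sn0; lia.
pose f (i : nat) := \sum_(1 <= h < L.+1) (sin (h%:R * pi / M)) ^- 2
     * (1 - cos (2 * pi * (h%:R * i%:R / M))).
have f0 : f 0%N = 0.
  by rewrite /f big1 // => h _; rewrite mulr0 mul0r mulr0 cos0 subrr mulr0.
have f1 : f 1%N = M - 1.
  rewrite /f (eq_big_nat _ _ (F2 := fun=> 2)); last first.
    move=> h /s0 sh.
    have -> : 2 * pi * (h%:R * 1%:R / M) = (h%:R * pi / M) *+ 2 by ring.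
    by rewrite cos_mulr2n cos2sin2; field.
  by rewrite sumr_const_nat subn1 -mulr_natr /= /M natrD natrM; ring.
have fS i : (0 < i < 2 * L + 1)%N -> f i.+1 = 2 * f i - f i.-1 - 2.
  case/andP; case: i => // i _ iL; rewrite /=.
  suff : f i.+2 - 2 * f i.+1 + f i = -2 by lra.
  have hx : sin (i.+1%:R * pi / M) != 0 by apply: sn0.
  have := sum_cos_dirichlet R (i.+1%:R * pi / M) L.
  have -> : (2 * L + 1)%:R * (i.+1%:R * pi / M) = i.+1%:R * pi.
    by rewrite -/M; field; rewrite gt_eqF.
  rewrite sin_pin => hd.
  have {hd} hd : \sum_(1 <= h < L.+1) cos (2 * h%:R * (i.+1%:R * pi / M)) = - (1 / 2).
    by apply: (mulfI hx); lra.
  transitivity (4 * \sum_(1 <= h < L.+1) cos (2 * h%:R * (i.+1%:R * pi / M))); last first.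
    by rewrite hd; lra.
  rewrite /f !mulr_sumr -sumrB -big_split /=; apply: eq_big_nat => h /s0 sh.
  have -> : 2 * pi * (h%:R * i.+2%:R / M)
     = 2 * h%:R * (i.+1%:R * pi / M) + (h%:R * pi / M) *+ 2.
    by rewrite -[i.+2%:R]natr1 -[i.+1%:R]natr1 ; ring.
  have -> : 2 * pi * (h%:R * i%:R / M)
     = 2 * h%:R * (i.+1%:R * pi / M) - (h%:R * pi / M) *+ 2.
    by rewrite -[i.+1%:R]natr1 ; ring.
  have -> : 2 * pi * (h%:R * i.+1%:R / M) = 2 * h%:R * (i.+1%:R * pi / M) by ring.
  by rewrite cosB cosD [cos (_ *+ 2)]cos_mulr2n cos2sin2; field.
suff main i : (i < 2 * L + 1)%N ->
    f i = i%:R * (M - i%:R) /\ f i.+1 = i.+1%:R * (M - i.+1%:R).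
  case: j jL => [|j] jL; last by have [] := main j jL.
  by rewrite -/(f 0%N) f0 mul0r.
elim: i => [|i IH] iL; first by rewrite f0 f1 mul0r mul1r.
have [IH0 IH1] := IH (ltnW iL).
split => //; rewrite fS // IH0 IH1 -!natr1; ring.
Qed.

(** * Sawtooth sums bounded by exponential sums *)

Lemma pi_le4 (R : realType) : pi <= 4 :> R.
Proof. by have [/andP[_ h] _] := pihalf_02_cos_pihalf R; lra. Qed.

Lemma ltn_half_mul2 h M : (h < M./2.+1)%N -> (2 * h <= M)%N.
Proof. lia. Qed.

Section OneSided.
Variables (R : realType) (M : nat).
Hypothesis M0 : (0 < M)%N.

(** [M ^ 2] times the function [{t} (1 - {t})] at [t = m / M]; up to sign and a constant,
    this is twice the primitive of the sawtooth [{t} - 1/2]. *)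
Let bet (m : nat) : R := (m %% M)%:R * (M%:R - (m %% M)%:R).

(** The sawtooth increases with slope one and jumps down, so that its value at a
    point is at most, up to the length of the window, its average over a window to the
    left, and at least its average over a window to the right. Averages
    over windows are divided differences of the primitive. *)
Lemma sawtooth_le m a : (a <= M)%N ->
  a%:R * (2 * (m %% M)%:R - M%:R) <= bet (m + (M - a)) - bet m + 2 * a%:R ^+ 2.
Proof.
move=> aM; rewrite /bet -[in X in _ <= X - _ + _]modnDml.
have : (m %% M < M)%N by rewrite ltn_mod.
set q := (m %% M)%N => qM.
have qMr : (q%:R : R) <= M%:R by rewrite ler_nat ltnW.
have a0 : 0 <= (a%:R : R) by [].
have q0 : 0 <= (q%:R : R) by [].
have [aq|qa] := leqP a q.
  have -> : ((q + (M - a)) %% M)%N = (q - a)%N.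
    have -> : (q + (M - a) = q - a + M)%N by lia.
    by rewrite modnDr modn_small //; lia.
  rewrite natrB //; nra.
rewrite modn_small; last by lia.
have qa' : (q%:R : R) <= a%:R by rewrite ler_nat ltnW.
rewrite natrD natrB //; nra.
Qed.

Lemma sawtooth_ge m a : (a <= M)%N ->
  bet m - bet (m + a) - 2 * a%:R ^+ 2 <= a%:R * (2 * (m %% M)%:R - M%:R).
Proof.
move=> aM; rewrite /bet -[in X in _ - X - _ <= _]modnDml.
have : (m %% M < M)%N by rewrite ltn_mod.
set q := (m %% M)%N => qM.
have a0 : 0 <= (a%:R : R) by [].
have aMr : (a%:R : R) <= M%:R by rewrite ler_nat.
have [qaM|qaM] := ltnP (q + a) M.
  by rewrite modn_small // natrD; nra.
have -> : ((q + a) %% M)%N = (q + a - M)%N.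
  rewrite -{1}(subnK qaM) modnDr modn_small //; lia.
have qaMr : (M%:R : R) <= q%:R + a%:R by rewrite -natrD ler_nat.
rewrite natrB // natrD; nra.
Qed.

End OneSided.

Lemma green_cos_mod (R : realType) (M m : nat) : odd M ->
  \sum_(1 <= h < M./2.+1) (sin (h%:R * pi / M%:R)) ^- 2
     * (1 - cos (2 * pi * (h%:R * m%:R / M%:R)))
  = (m %% M)%:R * (M%:R - (m %% M)%:R) :> R.
Proof.
move=> oM; have ME : M = (2 * M./2 + 1)%N by have := odd_double_half M; rewrite oM; lia.
have M0 : (0 < M)%N by rewrite ME addn1.
have qM : (m %% M < M)%N by rewrite ltn_mod.
have := @green_cos R M./2 (m %% M); rewrite -ME => <- //; last exact: ltnW.
apply: eq_bigr => h _; congr (_ * (1 - _)).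
rewrite -[RHS](cos_2pin _ _ (h * (m %/ M))); congr cos.
rewrite {1}(divn_eq m M) natrD !natrM.
by field; rewrite pnatr_eq0 -lt0n.
Qed.

Section Bridge.
Variables (R : realType) (s : seq nat) (w y : nat -> R) (k E : R) (a H M : nat).
Hypothesis k01 : 0 <= k <= 1.
Hypothesis oa : odd a.
Hypothesis oH : odd H.
Hypothesis MaH : M = (a * H)%N.
Hypothesis w0 : forall d, d \in s -> 0 <= w d.
Hypothesis y0 : forall d, d \in s -> 0 <= y d.
Hypothesis Hcos : forall h, (0 < h)%N ->
  `|\sum_(d <- s) w d * cos (2 * pi * (h%:R * y d))| <= E * h%:R `^ k.
Hypothesis Hsin : forall h, (0 < h)%N ->
  `|\sum_(d <- s) w d * sin (2 * pi * (h%:R * y d))| <= E * h%:R `^ k.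

Let W := \sum_(d <- s) w d.
Let m d := Num.truncn (M%:R * y d).
Let T (h : nat) d : R := 2 * pi * (h%:R * (m d)%:R / M%:R).

Let a0 : (0 < a)%N. Proof. exact: odd_gt0. Qed.
Let H0 : (0 < H)%N. Proof. exact: odd_gt0. Qed.
Let M0 : (0 < M)%N. Proof. by rewrite MaH muln_gt0 a0 H0. Qed.
Let Mr0 : 0 < (M%:R : R). Proof. by rewrite ltr0n. Qed.
Let W0 : 0 <= W. Proof. by rewrite /W big_seq sumr_ge0. Qed.

(** Moving a point to the grid costs [O (h / M)] at the frequency [h]. *)
Let trig_grid (f : R -> R) h : (forall u v, `|f u - f v| <= `|u - v|) -> (0 < h)%N ->
  `|\sum_(d <- s) w d * f (2 * pi * (h%:R * y d))| <= E * h%:R `^ k ->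
  `|\sum_(d <- s) w d * f (T h d)| <= E * h%:R `^ k + 8 * W * h%:R / M%:R.
Proof.
move=> fL h0 hf.
have -> : \sum_(d <- s) w d * f (T h d) =
  \sum_(d <- s) w d * f (2 * pi * (h%:R * y d))
  - \sum_(d <- s) w d * (f (2 * pi * (h%:R * y d)) - f (T h d)).
  by rewrite -sumrB; apply: eq_bigr => d _; ring.
apply: (le_trans (ler_normB _ _)); apply: lerD => //.
apply: (le_trans (ler_norm_sum _ _ _)).
have -> : 8 * W * h%:R / M%:R = W * (8 * h%:R / M%:R) by ring.
rewrite /W mulr_suml big_seq [leRHS]big_seq.
apply: ler_sum => d ds; rewrite normrM ger0_norm ?w0 //.
apply: ler_wpM2l; first exact: w0.
apply: (le_trans (fL _ _)).
have /andP[t0 t1] : (m d)%:R <= M%:R * y d < (m d).+1%:R.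
  by apply: truncn_itv; apply: mulr_ge0; [exact: ltW|exact: y0].
have -> : 2 * pi * (h%:R * y d) - T h d
   = 2 * pi * h%:R / M%:R * (M%:R * y d - (m d)%:R).
  by rewrite /T; field; rewrite gt_eqF.
have pi0 := pi_gt0 R; have pi4 := pi_le4 R.
have c0 : 0 <= 2 * pi * h%:R / (M%:R : R).
  by apply: divr_ge0; [apply: mulr_ge0 => //; lra|exact: ltW].
rewrite ger0_norm; last by apply: mulr_ge0 => //; rewrite subr_ge0.
apply: (le_trans (y := 2 * pi * h%:R / M%:R)).
  by apply: ler_piMr => //; rewrite lerBlDl natr1 ltW.
rewrite ler_pM2r ?invr_gt0 // ler_wpM2r //; lra.
Qed.

Let shift_bound h (phi mu : R) : (0 < h)%N -> `|sin phi| <= mu -> `|1 - cos phi| <= mu ->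
  `|\sum_(d <- s) w d * (cos (T h d) - cos (T h d + phi))|
  <= 2 * (mu * (E * h%:R `^ k + 8 * W * h%:R / M%:R)).
Proof.
move=> h0 hs hc.
have -> : \sum_(d <- s) w d * (cos (T h d) - cos (T h d + phi))
  = (1 - cos phi) * \sum_(d <- s) w d * cos (T h d)
    + sin phi * \sum_(d <- s) w d * sin (T h d).
  rewrite !mulr_sumr -big_split /=; apply: eq_bigr => d _; rewrite cosD; ring.
apply: (le_trans (ler_normD _ _)); rewrite !normrM.
have := trig_grid _ _ (@dist_cos R) h0 (Hcos _ h0).
have := trig_grid _ _ (@dist_sin R) h0 (Hsin _ h0).
move=> hA hB.
have := ler_pM (normr_ge0 _) (normr_ge0 _) hs hA.
have := ler_pM (normr_ge0 _) (normr_ge0 _) hc hB.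
lra.
Qed.

(** For [v = h / H], these are the factors through which averaging over windows of length
    [1 / H] enters the Fourier coefficients. The power [1 - k] offsets the growth
    [h ^ k] of the exponential sums so as to leave a harmonic series. *)
Let small_angle (v : R) : 0 <= v ->
  let mu := Num.min 2 (8 * v `^ (1 - k)) in
  `|sin (2 * pi * v)| <= mu /\ `|1 - cos (2 * pi * v)| <= mu.
Proof.
move=> v0 mu; have /andP[kge0 kle1] := k01.
have pi0 := pi_gt0 R; have pi4 := pi_le4 R.
have hs1 := sin_geN1 (2 * pi * v); have hs2 := sin_le1 (2 * pi * v).
have hc1 := cos_geN1 (2 * pi * v); have hc2 := cos_le1 (2 * pi * v).
have vE : 0 <= 2 * pi * v by rewrite !mulr_ge0 // ltW.
have hv : 2 <= 8 * v `^ (1 - k) \/ 2 * pi * v <= 8 * v `^ (1 - k).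
  have [v1|v1] := leP 1 v.
    left; suff : 1 <= v `^ (1 - k) by lra.
    have k1 : 0 <= 1 - k by lra.
    by have := ge0_ler_powR k1 _ _ v1; rewrite powR1 !nnegrE; apply.
  right; apply: (le_trans (y := 8 * v)); first by rewrite ler_wpM2r //; lra.
  rewrite ler_pM2l //; have [->|vn0] := eqVneq v 0; first exact: powR_ge0.
  by apply: ger1_powR; rewrite ?lt_def ?vn0 ?v0 ?(ltW v1) //; lra.
have := dist_sin R (2 * pi * v) 0; rewrite sin0 !subr0 => ds.
have := dist_cos R (2 * pi * v) 0; rewrite cos0 !subr0 distrC => dc.
rewrite [X in _ <= X]ger0_norm // in ds; rewrite [X in _ <= X]ger0_norm // in dc.
rewrite /mu !le_min; split; apply/andP; split.
- by rewrite ler_norml; apply/andP; split; lra.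
- by case: hv => ?; [rewrite ler_norml; apply/andP; split; lra|exact: le_trans ds _].
- by rewrite ler_norml; apply/andP; split; lra.
- by case: hv => ?; [rewrite ler_norml; apply/andP; split; lra|exact: le_trans dc _].
Qed.

Let bet (j : nat) : R := (j %% M)%:R * (M%:R - (j %% M)%:R).

Let harm := \sum_(1 <= h < M.+1) (h%:R^-1 : R).

Let bet_diff b : b = a \/ b = (M - a)%N ->
  `|\sum_(d <- s) w d * (bet (m d + b) - bet (m d))|
  <= 2 * a%:R * M%:R * (8 * E * H%:R `^ k + 16 * W * H%:R / M%:R) * harm.
Proof.
move=> hb; have oM : odd M by rewrite MaH oddM oa oH.
have ar0 : 0 < (a%:R : R) by rewrite ltr0n.
have Hr0 : 0 < (H%:R : R) by rewrite ltr0n.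
have ME : (M%:R : R) = a%:R * H%:R by rewrite MaH natrM.
have E0 : 0 <= E.
  by have := Hcos 1%N isT; rewrite powR1 mulr1; apply: le_trans.
(* Modulo M the two shifts are a and - a, that is, angles of 2 pi h / H up to sign. *)
pose phi (h : nat) : R := if b == a then 2 * pi * (h%:R / H%:R) else - (2 * pi * (h%:R / H%:R)).
have -> : \sum_(d <- s) w d * (bet (m d + b) - bet (m d))
  = \sum_(1 <= h < M./2.+1) sin (h%:R * pi / M%:R) ^- 2 *
      \sum_(d <- s) w d * (cos (T h d) - cos (T h d + phi h)).
  under [RHS]eq_bigr do rewrite mulr_sumr.
  rewrite exchange_big /=; apply: eq_bigr => d _.
  rewrite /bet -!green_cos_mod // -sumrB mulr_sumr; apply: eq_bigr => h _.
  rewrite -/(T h d).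
  have -> : cos (2 * pi * (h%:R * (m d + b)%:R / M%:R)) = cos (T h d + phi h).
    rewrite /phi; case: eqP => [->|ba].
      congr cos; rewrite /T natrD ME; field.
      by rewrite !gt_eqF.
    case: hb => // ->; rewrite -[RHS](cos_2pin _ _ h); congr cos.
    rewrite /T natrD natrB ?MaH ?leq_pmulr // -?MaH ME; field.
    by rewrite !gt_eqF.
  by ring.
apply: (le_trans (ler_norm_sum _ _ _)).
rewrite [leRHS]mulr_sumr.
have hle : (M./2.+1 <= M.+1)%N by rewrite ltnS leq_half_double -addnn ltnW // ltnS leq_addr.
rewrite [leRHS](big_cat_nat (isT : (1 <= M./2.+1)%N) hle) /=.
apply: ler_wpDr.
  have C0 : 0 <= 8 * E * H%:R `^ k + 16 * W * H%:R / (M%:R : R).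
    apply: addr_ge0; last by apply: divr_ge0 => //; do 2 apply: mulr_ge0 => //.
    by apply: mulr_ge0; [exact: mulr_ge0|exact: powR_ge0].
  have aM0 : 0 <= 2 * a%:R * (M%:R : R) by rewrite !mulr_ge0.
  by rewrite sumr_ge0 // => h _; apply: mulr_ge0; [exact: mulr_ge0|rewrite invr_ge0].
rewrite !big_nat; apply: ler_sum => h /andP[h0 hM].
have hr0 : 0 < (h%:R : R) by rewrite ltr0n.
have pi0 := pi_gt0 R; have pi2 := pi_ge2 R.
have hM2 : 2 * h%:R <= (M%:R : R) by rewrite -natrM ler_nat; exact: ltn_half_mul2.
have sb : h%:R / M%:R <= sin (h%:R * pi / M%:R : R).
  apply: (le_trans (y := h%:R * (pi : R) / M%:R / 2)); last first.
    apply: sin_ge_half; first by rewrite divr_ge0 ?mulr_ge0 // ltW.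
    rewrite ler_pdivrMr // mulrAC ler_pdivlMr //; nra.
  have -> : h%:R * pi / M%:R / 2 = h%:R / M%:R * (pi / 2) :> R by ring.
  by rewrite ler_peMr ?divr_ge0 //; lra.
have hM0 : 0 < h%:R / (M%:R : R) by apply: divr_gt0.
rewrite normrM ger0_norm; last by rewrite invr_ge0 exprn_ge0 // (le_trans (ltW hM0)).
have sb2 : sin (h%:R * pi / M%:R) ^- 2 <= (M%:R / h%:R) ^+ 2 :> R.
  have -> : (M%:R / h%:R) ^+ 2 = (h%:R / M%:R) ^- 2 :> R by rewrite -exprVn invf_div.
  rewrite lef_pV2 ?posrE ?exprn_gt0 //.
    by apply: lerXn2r; rewrite ?nnegrE ?(ltW hM0) // (le_trans (ltW hM0)).
  exact: lt_le_trans sb.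
pose u : R := h%:R / H%:R.
have u0 : 0 <= u by apply: divr_ge0.
have [ms mc] := small_angle _ u0.
set mu := Num.min _ _ in ms mc.
have Z : `|\sum_(d <- s) w d * (cos (T h d) - cos (T h d + phi h))|
  <= 2 * (mu * (E * h%:R `^ k + 8 * W * h%:R / M%:R)).
  apply: shift_bound => //; rewrite /phi; case: eqP => // _.
    by rewrite sinN normrN.
  by rewrite cosN.
apply: (le_trans (ler_pM _ (normr_ge0 _) sb2 Z)).
  by rewrite invr_ge0 exprn_ge0 // (le_trans (ltW hM0)).
have mu1 : mu <= 2 by rewrite ge_min lexx.
have mu2 : mu <= 8 * u `^ (1 - k) by rewrite ge_min lexx orbT.
have ES : 0 <= E * h%:R `^ k by rewrite mulr_ge0 ?powR_ge0.
have WS : 0 <= 8 * W * h%:R / M%:R by rewrite divr_ge0 ?mulr_ge0.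
have key : mu * (E * h%:R `^ k + 8 * W * h%:R / M%:R)
   <= 8 * E * H%:R `^ k * h%:R / H%:R + 16 * W * h%:R / M%:R.
  rewrite mulrDr; apply: lerD; last first.
    apply: (le_trans (ler_wpM2r WS mu1)); lra.
  apply: (le_trans (ler_wpM2r ES mu2)).
  have -> : u `^ (1 - k) = h%:R `^ (1 - k) * H%:R `^ k / H%:R.
    rewrite /u powRM ?invr_ge0 // -powR_inv1 // -powRrM -mulrA -powRD; last first.
      by apply/implyP => _; rewrite gt_eqF.
    by congr (_ * _ `^ _); ring.
  have hE : h%:R `^ (1 - k) * h%:R `^ k = h%:R :> R.
    rewrite -powRD ?subrK ?powRr1 //.
    by apply/implyP => _; rewrite gt_eqF.
  rewrite -[in X in _ <= X]hE; lra.
apply: (le_trans (ler_wpM2l (sqr_ge0 (M%:R / h%:R)) (ler_wpM2l (ler0n R 2) key))).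
rewrite le_eqVlt; apply/orP; left; apply/eqP.
rewrite ME; field.
by rewrite !gt_eqF.
Qed.

(** A finite substitute for the approximation of the sawtooth by trigonometric
    polynomials, for weights whose exponential sums grow at most like a power
    [h ^ k], [k <= 1], of the frequency. Replacing the sawtooth by its average over
    windows of length [1 / H] costs [W / H], while the Fourier coefficients of that
    average decay fast enough for the frequencies beyond [H] to cost no
    more than those below. Working on the grid of mesh [1 / M] keeps the
    Fourier expansion finite, at the price of the term with [W * H / M]. *)
Lemma sawtooth_sum :
  `|\sum_(d <- s) w d * (y d - (Num.truncn (y d))%:R - 1 / 2)|
  <= (8 * E * H%:R `^ k + 16 * W * H%:R / M%:R) * harm + 2 * W / H%:R.
Proof.
have ar0 : 0 < (a%:R : R) by rewrite ltr0n.
have ar1 : 1 <= (a%:R : R) by rewrite ler1n.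
have Hr0 : 0 < (H%:R : R) by rewrite ltr0n.
have ME : (M%:R : R) = a%:R * H%:R by rewrite MaH natrM.
have aM : (a <= M)%N by rewrite MaH leq_pmulr.
have aM0 : 0 < 2 * a%:R * (M%:R : R) by rewrite !mulr_gt0.
pose th d : R := y d - (Num.truncn (y d))%:R - 1 / 2.
have grid d : d \in s ->
    0 <= th d - ((m d %% M)%:R / M%:R - 1 / 2) <= M%:R^-1.
  move=> ds.
  have /andP[t0 t1] : (m d)%:R <= M%:R * y d < (m d).+1%:R.
    by apply: truncn_itv; apply: mulr_ge0; [exact: ltW|exact: y0].
  (* A point and its grid approximation have the same integer part. *)
  have mE : (m d %/ M)%N = Num.truncn (y d).
    have /andP[f0 f1] := truncn_itv (y0 _ ds).
    apply/eqP; rewrite eqn_leq -ltnS; apply/andP; split.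
      rewrite ltn_divLR // -(ltr_nat R) natrM; apply: le_lt_trans t0 _.
      by rewrite mulrC ltr_pM2r.
    rewrite leq_divRL // /m -(ler_nat R).
    rewrite -[leLHS]/(_ : R); rewrite ler_nat truncn_ge_nat ?mulr_ge0 ?y0 //.
    by rewrite natrM mulrC ler_pM2l.
  have hm : (m d)%:R = (Num.truncn (y d))%:R * M%:R + (m d %% M)%:R :> R.
    by rewrite -mE -natrM -natrD -divn_eq.
  have -> : th d - ((m d %% M)%:R / M%:R - 1 / 2) = (M%:R * y d - (m d)%:R) / M%:R.
    by rewrite hm /th; field; rewrite gt_eqF.
  rewrite divr_ge0 ?subr_ge0 //= ler_pdivrMr // mulVf ?gt_eqF // lerBlDl natr1.
  exact: ltW.
have Wsum (c : R) : W * c = \sum_(d <- s) w d * c by rewrite /W mulr_suml.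
have eps_le : 2 * W / H%:R >= W * (a%:R / M%:R + M%:R^-1).
  have -> : 2 * W / H%:R = W * (2 / H%:R) by ring.
  rewrite ler_wpM2l // -[X in _ / _ + X]mul1r -mulrDl ler_pdivrMr // ME.
  have -> : 2 / H%:R * (a%:R * H%:R) = 2 * a%:R :> R by field; rewrite gt_eqF.
  lra.
have upper : \sum_(d <- s) w d * th d
    <= (\sum_(d <- s) w d * (bet (m d + (M - a)) - bet (m d))) / (2 * a%:R * M%:R)
       + W * (a%:R / M%:R + M%:R^-1).
  rewrite Wsum mulr_suml -big_split /= big_seq [leRHS]big_seq.
  apply: ler_sum => d ds; rewrite -mulrA -mulrDr; apply: ler_wpM2l; first exact: w0.
  have /andP[_ g2] := grid d ds.
  have := sawtooth_le R M M0 (m d) a aM; rewrite -/(bet _) -/(bet (m d)) => up.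
  have : (m d %% M)%:R / M%:R - 1 / 2 - a%:R / M%:R
     <= (bet (m d + (M - a)) - bet (m d)) / (2 * a%:R * M%:R).
    rewrite ler_pdivlMr //; apply: (le_trans (y := a%:R * (2 * (m d %% M)%:R - M%:R) - 2 * a%:R ^+ 2)); last by lra.
    rewrite le_eqVlt; apply/orP; left; apply/eqP; field.
    by rewrite gt_eqF.
  lra.
have lower : \sum_(d <- s) w d * th d
    >= - ((\sum_(d <- s) w d * (bet (m d + a) - bet (m d))) / (2 * a%:R * M%:R))
       - W * (a%:R / M%:R + M%:R^-1).
  rewrite Wsum mulr_suml -sumrN -sumrB big_seq [leRHS]big_seq.
  apply: ler_sum => d ds; rewrite -mulrA -mulrN -mulrBr; apply: ler_wpM2l; first exact: w0.
  have /andP[g1 _] := grid d ds.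
  have := sawtooth_ge R M M0 (m d) a aM; rewrite -/(bet _) -/(bet (m d + a)) => lo.
  have : - ((bet (m d + a) - bet (m d)) / (2 * a%:R * M%:R))
     <= (m d %% M)%:R / M%:R - 1 / 2 + a%:R / M%:R.
    rewrite -mulNr ler_pdivrMr //; apply: (le_trans (y := a%:R * (2 * (m d %% M)%:R - M%:R) + 2 * a%:R ^+ 2)); first by lra.
    rewrite le_eqVlt; apply/orP; left; apply/eqP; field.
    by rewrite gt_eqF.
  have : 0 <= (M%:R : R)^-1 by rewrite invr_ge0.
  lra.
have cancel (X Y : R) : `|X| <= 2 * a%:R * M%:R * Y * harm ->
    `|X / (2 * a%:R * M%:R)| <= Y * harm.
  move=> hX; rewrite normrM normfV (ger0_norm (ltW aM0)) ler_pdivrMr //; lra.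
have hu := cancel _ _ (bet_diff _ (or_intror erefl)).
have hl := cancel _ _ (bet_diff _ (or_introl erefl)).
move: hu hl; rewrite !ler_norml => /andP[hu1 hu2] /andP[hl1 hl2].
apply/andP; split; lra.
Qed.
End Bridge.

(** * Exponent pairs applied to reciprocal phases *)

Section ReciprocalPhase.
Local Open Scope classical_set_scope.

(** With [u = 1 / (a y + b)] and [v = 1 / (a t + b)], [u - v = - a (y - t) u v], so that the
    difference quotient of the power [n] is a polynomial in [u], continuous at [t]. *)
Lemma has_deriv_within_recip (R : realType) (A : set R) (a b c t : R) (n : nat) :
  a * t + b != 0 ->
  has_deriv_within A (fun u => c * (a * u + b)^-1 ^+ n) t
    (- (c * n%:R * a) * (a * t + b)^-1 ^+ n.+1).
Proof.
move=> wt; apply: cvg_within_filter.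
pose u y : R := (a * y + b)^-1.
pose g y : R := - (c * a) * (u y * u t * \sum_(i < n) u y ^+ (n.-1 - i) * u t ^+ i).
have cu : u y @[y --> t^'] --> u t.
  apply: cvg_within_filter; apply: cvgV => //.
  by apply: cvgD; [apply: cvgMr; exact: cvg_id|exact: cvg_cst].
have -> : - (c * n%:R * a) * (a * t + b)^-1 ^+ n.+1 = g t.
  rewrite /g (eq_bigr (fun=> u t ^+ n.-1)); last first.
    by move=> i _; rewrite -exprD subnK // -ltnS prednK ?(leq_ltn_trans _ (ltn_ord i)) //.
  rewrite sumr_const card_ord -mulr_natr -/(u t).
  case: (n) => [|m]; first by rewrite /=; ring.
  by rewrite /= !exprS; ring.
have cg : g y @[y --> t^'] --> g t.
  apply: cvgMr; apply: cvgM; first by apply: cvgMl.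
  apply: cvg_big => [|i _]; first by move=> x; exact: add_continuous.
  apply: cvgMl.
  exact: (cvg_comp u (fun z => z ^+ (n.-1 - i)) cu (@exprn_continuous R _ (u t))).
apply: cvg_trans cg; apply: near_eq_cvg.
have hw : \forall y \near t^', a * y + b != 0.
  have : (a * y + b) @[y --> t^'] --> a * t + b.
    by apply: cvg_within_filter; apply: cvgD; [apply: cvgMr; exact: cvg_id|exact: cvg_cst].
  by move/cvgr_neq0; apply.
near=> y.
have yt : y != t by near: y; exact: nbhs_dnbhs_neq.
have wy : a * y + b != 0 by near: y.
have yt0 : y - t != 0 by rewrite subr_eq0.
have uy : u y - u t = - a * (y - t) * (u y * u t).
  by rewrite /u; field; rewrite wt wy.
have -> : c * (a * y + b)^-1 ^+ n - c * (a * t + b)^-1 ^+ n = c * (u y ^+ n - u t ^+ n).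
  by rewrite mulrBr.
rewrite subrXX uy /g.
set S := \sum_(i < n) _.
by field.
Unshelve. all: by end_near.
Qed.

End ReciprocalPhase.

Lemma sum_e_real (R : realType) (f : nat -> R) (m n : nat) (b : R) :
  `|\sum_(m <= i < n) e (f i)| <= (b%:C)%C ->
  `|\sum_(m <= i < n) cos (2 * pi * f i)| <= b /\
  `|\sum_(m <= i < n) sin (2 * pi * f i)| <= b.
Proof.
have -> : \sum_(m <= i < n) e (f i) =
   ((\sum_(m <= i < n) cos (2 * pi * f i)) +i* (\sum_(m <= i < n) sin (2 * pi * f i)))%C.
  by elim/big_rec3: _ => // i x y z _ ->.
rewrite normc_def lecR /=; set x := \sum_(_ <= _ < _) _; set y := \sum_(_ <= _ < _) _.
by move=> h; split; apply: le_trans h; rewrite -sqrtr_sqr ler_wsqrtr // ?lerDl ?lerDr sqr_ge0.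
Qed.

(** The defining property of an exponent pair for the phases [z / (M * n + delta)]:
    on [A <= t <= 2 * A] the [j]-th derivative has the size
    [j! * T * A ^- j], [T = z / (M * A)], up to a factor between [3 ^- j.+1] and [1],
    so that one constant serves for all [z], [M], [delta]. *)
Lemma exponent_pair_recip (R : realType) (k l : R) : exponent_pair k l ->
  exists2 K : R, 0 <= K & forall (D D' Y M : nat) (delta z : R) (f : R -> R),
    f = cos \/ f = sin -> (0 < D)%N -> (D' <= 2 * D)%N -> (0 < M)%N -> (0 < Y)%N ->
    0 <= delta <= 1 -> 0 < z ->
    `|\sum_(1 <= n < D'.+1 | (D < M * n <= D')%N && (Y < n)%N)
        f (2 * pi * (z / ((M * n)%:R + delta)))|
    <= K * ((z / D%:R) `^ k * (2 * D%:R / M%:R) `^ (l - k)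
            + 4 * D%:R ^+ 2 / (M%:R * z)).
Proof.
move=> [k0 k1 l0 l1 ep].
have f0 (j : nat) : 0 < (j`!%:R : R) by rewrite ltr0n fact_gt0.
have c0 (j : nat) : 0 < j`!%:R / 3 ^+ j.+1 :> R by rewrite divr_gt0 ?exprn_gt0.
have [K0 epK] := ep _ _ c0 f0.
exists `|K0| => // D D' Y M delta z f hf D0 DD' M0 Y0 /andP[d0 d1] z0.
have Dr0 : 0 < (D%:R : R) by rewrite ltr0n.
have Mr0 : 0 < (M%:R : R) by rewrite ltr0n.
have Mr1 : 1 <= (M%:R : R) by rewrite ler1n.
set rhs := (X in _ <= X).
have rhs0 : 0 <= rhs.
  apply: mulr_ge0 => //; apply: addr_ge0; first by rewrite mulr_ge0 ?powR_ge0.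
  by apply: divr_ge0; apply: mulr_ge0; rewrite ?sqr_ge0 ?(ltW z0).
(* The long variable runs over the integers of the real interval from A to B. *)
pose A : R := Num.max Y%:R (D%:R / M%:R); pose B : R := D'%:R / M%:R.
have A1 : 1 <= A by rewrite le_max ler1n Y0.
have DA : D%:R <= M%:R * A.
  by rewrite mulrC -ler_pdivrMr // le_max lexx orbT.
have A0 : 0 < A by apply: lt_le_trans A1.
have AN : 0 <= A by apply: ltW.
have B0 : 0 <= B by apply: divr_ge0.
have hsum (g : nat -> R) : \sum_(1 <= n < D'.+1 | (D < M * n <= D')%N && (Y < n)%N) g n
   = \sum_((Num.truncn A).+1 <= n < (Num.truncn B).+1) g n.
  have sB : ((Num.truncn B).+1 <= D'.+1)%N.
    rewrite ltnS truncn_le_nat; apply: (le_lt_trans (y := D'%:R)); last by rewrite ltr_nat.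
    by rewrite ler_pdivrMr // ler_peMr.
  rewrite [RHS](big_nat_widen _ _ _ _ _ sB) [RHS](big_nat_widenl _ 1) //=.
  apply: eq_bigl => n; rewrite /= !ltnS truncn_lt_nat // truncn_ge_nat //.
  rewrite gt_max ltr_nat ltr_pdivrMr // ler_pdivlMr // -!natrM ltr_nat ler_nat.
  by rewrite ?(mulnC n M); case: (D < M * n)%N; case: (M * n <= D')%N; case: (Y < n)%N.
rewrite hsum.
have [BA|AB] := leP B A.
  rewrite big_geq ?normr0 // ltnS; exact: le_truncn.
have B2 : B <= 2 * A.
  rewrite ler_pdivrMr // -mulrA (mulrC A).
  apply: (le_trans (y := 2 * D%:R)); first by rewrite -natrM ler_nat.
  by rewrite ler_pM2l.
pose T : R := z / (M%:R * A).
have MA0 : 0 < M%:R * A by apply: mulr_gt0.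
have MA1 : 1 <= M%:R * A by apply: le_trans DA; rewrite ler1n.
have T0 : 0 < T by apply: divr_gt0.
pose G (j : nat) (t : R) : R :=
  ((-1) ^+ j * j`!%:R * z * M%:R ^+ j) * (M%:R * t + delta)^-1 ^+ j.+1.
pose F (t : R) : R := z / (M%:R * t + delta).
have tw t : t \in `[A, 2 * A] -> M%:R * A <= M%:R * t + delta <= 3 * (M%:R * A).
  rewrite in_itv /= => /andP[tA t2A]; apply/andP; split.
    by rewrite -[leLHS]addr0 lerD // ler_pM2l.
  have : M%:R * t <= M%:R * (2 * A) by rewrite ler_pM2l.
  lra.
have tw0 t : t \in `[A, 2 * A] -> 0 < M%:R * t + delta.
  by move=> /tw /andP[h _]; apply: lt_le_trans h.
have hF t : t \in `[A, 2 * A] -> 0 < F t by move=> /tw0 h; apply: divr_gt0.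
have hG : smooth_derivs [set` `[A, 2 * A]] F G.
  split=> [t _|j t /tw0 h]; first by rewrite /G /F !expr0 expr1 fact0; ring.
  have := @has_deriv_within_recip R [set` `[A, 2 * A]] M%:R delta
    ((-1) ^+ j * j`!%:R * z * M%:R ^+ j) t j.+1 (lt0r_neq0 h).
  by congr (has_deriv_within _ _ _ _); rewrite /G factS natrM !exprS; ring.
have hB (j : nat) t : t \in `[A, 2 * A] ->
    (j`!%:R / 3 ^+ j.+1) * (T * A ^- j) <= `|G j t| <= j`!%:R * (T * A ^- j).
  move=> ht; have w0 := tw0 t ht; have /andP[w1 w2] := tw t ht.
  have -> : `|G j t| = j`!%:R * z * M%:R ^+ j * (M%:R * t + delta) ^- j.+1.
    rewrite /G !normrM normr_sign mul1r !normrX normfV exprVn.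
    by rewrite !ger0_norm ?exprn_ge0 // ltW.
  have C0 : 0 <= j`!%:R * z * M%:R ^+ j by rewrite !mulr_ge0 ?exprn_ge0 // ltW.
  have -> : (j`!%:R / 3 ^+ j.+1) * (T * A ^- j)
     = j`!%:R * z * M%:R ^+ j * (3 * (M%:R * A)) ^- j.+1.
    rewrite /T !exprMn !exprS; field.
    by rewrite !gt_eqF ?exprn_gt0.
  have -> : j`!%:R * (T * A ^- j) = j`!%:R * z * M%:R ^+ j * (M%:R * A) ^- j.+1.
    rewrite /T !exprMn !exprS; field.
    by rewrite !gt_eqF ?exprn_gt0.
  apply/andP; split; apply: ler_wpM2l => //.
    by rewrite lef_pV2 ?posrE ?exprn_gt0 ?mulr_gt0 //; apply: lerXn2r; rewrite ?nnegrE ?(ltW w0) // ltW ?mulr_gt0.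
  by rewrite lef_pV2 ?posrE ?exprn_gt0 //; apply: lerXn2r; rewrite ?nnegrE // ltW.
have := epK A B T F G A1 AB B2 T0 hF hG hB.
have hT : K0 * (T `^ k * A `^ (l - k) + A / T) <= rhs.
  have X0 : 0 <= T `^ k * A `^ (l - k) + A / T.
    by apply: addr_ge0; [rewrite mulr_ge0 ?powR_ge0|rewrite divr_ge0 ?(ltW T0)].
  apply: (le_trans (ler_wpM2r X0 (ler_norm K0))); apply: ler_wpM2l => //.
  have A2 : A <= 2 * D%:R / M%:R.
    apply: (le_trans (ltW AB)); rewrite ler_pM2r ?invr_gt0 //.
    by rewrite -natrM ler_nat.
  apply: lerD.
    apply: ler_pM; rewrite ?powR_ge0 //.
      apply: ge0_ler_powR; rewrite ?nnegrE //; first exact: ltW.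
        by rewrite divr_ge0 // ltW.
      by rewrite ler_pM2l // lef_pV2.
    by apply: ge0_ler_powR; rewrite ?nnegrE ?divr_ge0 ?mulr_ge0 //; lra.
  have -> : A / T = A ^+ 2 * (M%:R / z) by rewrite /T; field; rewrite !gt_eqF.
  have -> : 4 * D%:R ^+ 2 / (M%:R * z) = (2 * D%:R / M%:R) ^+ 2 * (M%:R / z).
    by field; rewrite !gt_eqF.
  apply: ler_wpM2r; first by rewrite divr_ge0 // ltW.
  by apply: lerXn2r => //; rewrite nnegrE ?divr_ge0 ?mulr_ge0.
move=> /sum_e_real[hc hs].
case: hf => ->; apply: le_trans hT.
  by apply: le_trans hc; rewrite le_eqVlt; apply/orP; left; apply/eqP;
    congr `|_|; apply: eq_bigr => n _; rewrite natrM.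
by apply: le_trans hs; rewrite le_eqVlt; apply/orP; left; apply/eqP;
    congr `|_|; apply: eq_bigr => n _; rewrite natrM.
Qed.

(** * Elementary sums, the series and the floor quotients *)

Lemma harmonic_le_powR (R : realType) (eps : R) : 0 < eps ->
  exists2 C : R, 0 <= C & forall N, (0 < N)%N ->
    \sum_(1 <= h < N.+1) (h%:R^-1 : R) <= C * N%:R `^ eps.
Proof.
move=> e0; exists (1 + eps^-1); first by rewrite addr_ge0 // invr_ge0 ltW.
move=> N N0.
have N1 : 1 <= (N%:R : R) by rewrite ler1n.
have NE : 1 <= (N%:R : R) `^ eps.
  by rewrite -[leLHS](powRr0 (N%:R : R)); apply: ler_powR => //; exact: ltW.
apply: (le_trans (y := 1 + ln (N%:R : R))); last first.
  rewrite mulrDl mul1r; apply: lerD => //.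
  rewrite mulrC ler_pdivlMr // mulrC -ln_powR.
  have NE1 : -1 < (N%:R : R) `^ eps - 1 by lra.
  have := le_ln1Dx NE1; rewrite [1 + _]addrC subrK => h.
  by apply: (le_trans h); rewrite gerBl.
elim: N N0 {N1 NE} => // N IH _; have [->|N0] := posnP N.
  by rewrite big_nat1 invr1 ln1 addr0.
rewrite big_nat_recr //=.
suff h : (N.+1%:R^-1 : R) <= ln N.+1%:R - ln N%:R.
  by apply: (le_trans (lerD (IH N0) h)); rewrite -addrA [ln N%:R + _]addrC subrK.
have Nr : 0 < (N%:R : R) by rewrite ltr0n.
have NSr : 0 < (N.+1%:R : R) by rewrite ltr0n.
rewrite -ln_div ?posrE // -[leLHS]opprK -[leRHS]opprK lerN2 -lnV ?posrE ?divr_gt0 //.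
rewrite invf_div.
have -> : N%:R / N.+1%:R = 1 + - (N.+1%:R^-1) :> R.
  by rewrite -[X in X / _](addrK 1) natr1 mulrBl divff ?gt_eqF // mul1r.
by apply: le_ln1Dx; rewrite ltrN2 invf_lt1 // ltr1n ltnS.
Qed.

(** [n ^ (eps - 1)] decreases at each step by at least a constant times the term
    to be summed, because [(1 + 1/n) ^ eps] is only [1 + O(eps/n)]. *)
Lemma powR_telescope (R : realType) (eps : R) (n : nat) : 0 < eps <= 1 / 4 ->
  (0 < n)%N ->
  n%:R `^ eps / (n%:R * (n%:R + 1))
  <= 2 * (n%:R `^ (eps - 1) - n.+1%:R `^ (eps - 1)).
Proof.
move=> /andP[e0 e1] n0.
have n1 : 1 <= (n%:R : R) by rewrite ler1n.
have nr : 0 < (n%:R : R) by rewrite ltr0n.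
have nSr : 0 < (n.+1%:R : R) by rewrite ltr0n.
pose q : R := (1 + n%:R^-1) `^ eps.
have in0 : 0 < (n%:R : R)^-1 by rewrite invr_gt0.
have qle : q * (1 - eps / n%:R) <= 1.
  have q0 : 0 < q by apply: powR_gt0; lra.
  have : q <= expR (eps / n%:R).
    rewrite /q /powR ifF; last by apply/negbTE; rewrite gt_eqF //; lra.
    rewrite ler_expR ler_pM2l //; apply: le_ln1Dx; lra.
  have := expR_ge1Dx (- (eps / (n%:R : R))).
  rewrite expRN => h1 h2.
  apply: (le_trans (y := q * (expR (eps / n%:R))^-1)).
    by apply: ler_wpM2l => //; exact: ltW.
  by rewrite ler_pdivrMr ?expR_gt0 // mul1r.
have qn : q * n%:R <= n%:R + 1 / 2.
  have he : eps / n%:R <= 1 / 4.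
    by rewrite ler_pdivrMr //; nra.
  have h1 : 0 < 1 - eps / n%:R by lra.
  rewrite -(ler_pM2r h1).
  apply: (le_trans (y := n%:R)).
    by rewrite mulrAC ler_piMl.
  have -> : (n%:R + 1 / 2) * (1 - eps / n%:R) = n%:R + 1 / 2 - eps - eps / n%:R / 2.
    by field; rewrite gt_eqF.
  lra.
have E (m : nat) : (0 < m)%N -> (m%:R : R) `^ (eps - 1) = m%:R `^ eps / m%:R.
  move=> m0; rewrite powRB ?powRr1 //; apply/implyP => _; by rewrite pnatr_eq0 -lt0n.
rewrite !E //.
have -> : n.+1%:R `^ eps = n%:R `^ eps * q :> R.
  have q1 : 0 <= 1 + (n%:R : R)^-1 by lra.
  rewrite /q -powRM //.
  by congr (_ `^ _); rewrite mulrDr mulr1 divff ?gt_eqF // natr1.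
have -> : n%:R `^ eps / (n%:R * (n%:R + 1)) = n%:R `^ eps * (n%:R * n.+1%:R)^-1 :> R.
  by rewrite natr1.
have -> : 2 * (n%:R `^ eps / n%:R - n%:R `^ eps * q / n.+1%:R)
   = n%:R `^ eps * (2 * (n.+1%:R - q * n%:R) / (n%:R * n.+1%:R)).
  by move: nr nSr; move: (n%:R) (n.+1%:R) => u v u0 v0; field; rewrite !gt_eqF.
apply: ler_wpM2l; first exact: powR_ge0.
rewrite -[leLHS]mul1r ler_pM2r ?invr_gt0 ?mulr_gt0 //.
have := @natr1 R n; lra.
Qed.

Section SeriesTail.
Local Open Scope classical_set_scope.

(** The bound for the tail telescopes by [powR_telescope]. The limit being unique, bounds
    obtained with different values of [eps] concern the same sum. *)
Lemma series_tail (R : realType) (f : nat -> R) (C eps : R) :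
  0 < eps <= 1 / 4 -> (forall n, 0 <= f n) ->
  (forall n, (0 < n)%N -> f n <= C * n%:R `^ eps) ->
  exists2 S : R,
    (\sum_(1 <= n < N.+1) f n / (n%:R * (n%:R + 1)) @[N --> \oo] --> S) &
    forall N, 0 <= S - \sum_(1 <= n < N.+1) f n / (n%:R * (n%:R + 1))
                <= 2 * C * N.+1%:R `^ (eps - 1).
Proof.
move=> he f0 fC.
pose P N := \sum_(1 <= n < N.+1) f n / (n%:R * (n%:R + 1)).
have C0 : 0 <= C by have := fC 1%N isT; rewrite powR1 mulr1; apply: le_trans.
have t0 n : 0 <= f n / (n%:R * (n%:R + 1)).
  by apply: divr_ge0 => //; apply: mulr_ge0 => //; rewrite natr1.
have Pm : nondecreasing_seq P.
  apply/nondecreasing_seqP => n; rewrite /P [leRHS]big_nat_recr //=.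
  by rewrite lerDl.
have diff N j : P (N + j)%N - P N
    <= 2 * C * (N.+1%:R `^ (eps - 1) - (N + j).+1%:R `^ (eps - 1)).
  elim: j => [|j IH]; first by rewrite addn0 !subrr mulr0.
  rewrite addnS /P big_nat_recr //= -/(P (N + j)%N) -/(P N).
  have h : f (N + j).+1 / ((N + j).+1%:R * ((N + j).+1%:R + 1))
    <= C * (2 * ((N + j).+1%:R `^ (eps - 1) - (N + j).+2%:R `^ (eps - 1))).
    apply: le_trans (ler_wpM2l C0 (powR_telescope _ _ (N + j).+1 he isT)).
    rewrite mulrA ler_pM2r ?fC // invr_gt0 mulr_gt0 ?ltr0n // natr1 ltr0n //.
  rewrite addrAC; apply: (le_trans (lerD IH h)).
  by rewrite le_eqVlt; apply/orP; left; apply/eqP; ring.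
have PU N j : P j <= P N + 2 * C * N.+1%:R `^ (eps - 1).
  have [jN|Nj] := leqP j N.
    apply: (le_trans (Pm _ _ jN)); rewrite lerDl mulr_ge0 ?powR_ge0 //.
    by rewrite mulr_ge0.
  have := diff N (j - N)%N; rewrite subnKC ?(ltnW Nj) //.
  have : 0 <= 2 * C * j.+1%:R `^ (eps - 1) by rewrite !mulr_ge0 ?powR_ge0.
  lra.
have cP : cvgn P.
  apply: nondecreasing_is_cvgn => //.
  exists (P 0%N + 2 * C * 1%:R `^ (eps - 1)) => _ [j _ <-]; exact: PU.
exists (limn P); first exact: cP.
move=> N; rewrite subr_ge0; apply/andP; split.
  exact: nondecreasing_cvgn_le.
rewrite lerBlDl; apply: limr_le => //.
by apply: nearW => j; exact: PU.
Qed.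

End SeriesTail.

(** Grouping the [n] with [floor (x / n) = d]: they fill the interval
    [x / (d + 1) < n <= x / d]. *)
Lemma sum_floor_quotients (R : realType) (f : nat -> R) (x : R) (Q : nat) : 0 <= x ->
  \sum_(1 <= n < (Num.truncn x).+1) f (Num.truncn (x / n%:R))
  = \sum_(1 <= n < (Num.truncn (x / Q.+1%:R)).+1) f (Num.truncn (x / n%:R))
    + \sum_(1 <= d < Q.+1)
        f d * ((Num.truncn (x / d%:R))%:R - (Num.truncn (x / d.+1%:R))%:R).
Proof.
move=> x0; elim: Q => [|Q IH]; first by rewrite divr1 [X in _ + X]big_geq ?addr0.
rewrite IH [in RHS](big_nat_recr Q.+1) //= [RHS]addrCA [LHS]addrC; congr (_ + _).
set b := Num.truncn (x / Q.+1%:R); set a := Num.truncn (x / Q.+2%:R).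
have ab : (a <= b)%N.
  apply: le_truncn; apply: ler_wpM2l => //.
  by rewrite lef_pV2 ?posrE ?ltr0n // ler_nat.
rewrite (big_cat_nat (n := a.+1)) //= ?ltnS //; congr (_ + _).
rewrite (eq_big_nat _ _ (F2 := fun=> f Q.+1)).
  by rewrite sumr_const_nat subSS -natrB // mulr_natr.
move=> n /andP[an nb]; congr f; apply: truncn_def.
have n0 : 0 < (n%:R : R) by rewrite ltr0n (leq_trans _ an).
move: an nb; rewrite ltnS /a /b truncn_lt_nat ?divr_ge0 // truncn_ge_nat ?divr_ge0 //.
rewrite ltr_pdivrMr ?ltr0n // ler_pdivlMr ?ltr0n // => h1 h2.
by rewrite ler_pdivlMr // ltr_pdivrMr // mulrC h2 mulrC h1.
Qed.

(** * Exponential sums with divisor coefficients *)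

Lemma powRD_gt0 (R : realType) (x a b : R) : 0 < x -> x `^ (a + b) = x `^ a * x `^ b.
Proof. by move=> x0; rewrite powRD //; apply/implyP => _; rewrite gt_eqF. Qed.

Lemma powR_ge1 (R : realType) (x a : R) : 1 <= x -> 0 <= a -> 1 <= x `^ a.
Proof. by move=> x1 a0; rewrite -[leLHS](powRr0 x); apply: ler_powR. Qed.

Lemma ge0_powR_le (R : realType) (x y a : R) : 0 <= a -> 0 <= x -> x <= y ->
  x `^ a <= y `^ a.
Proof.
by move=> a0 x0 xy; apply: ge0_ler_powR; rewrite ?nnegrE // (le_trans x0).
Qed.

(** In the dissection of [tau r] with [Y = D ^ (1/r)] the long variable exceeds [Y], so
    the product [m] of the others is at most [2 * D ^ (1 - 1/r)]. The exponent pair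
    gives a saving that decreases with [m], and the worst [m] determines the
    power of [D]. *)
Lemma tau_exp_sum (R : realType) (r : nat) (k l eps : R) : (1 <= r)%N ->
  exponent_pair k l -> 0 < eps ->
  exists2 C : R, 0 <= C & forall (D D' h : nat) (delta x : R) (f : R -> R),
    f = cos \/ f = sin -> (0 < D)%N -> (D' <= 2 * D)%N -> (0 < h)%N ->
    0 <= delta <= 1 -> 1 <= x ->
    `|\sum_(D.+1 <= d < D'.+1)
        (tau r d)%:R * f (2 * pi * (h%:R * (x / (d%:R + delta))))|
    <= C * D%:R `^ eps
       * (x `^ k * D%:R `^ (1 - k - (1 - (l - k)) / r%:R) + D%:R ^+ 2 / x) * h%:R `^ k.
Proof.
move=> r1 ep e0; have [k0 k1 l0 l1 _] := ep.
have [K K0 HK] := exponent_pair_recip _ _ _ ep.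
have e2 : 0 < eps / 2 by lra.
have [C1 C11 HC1] := tau_bound _ _ _ r1 e2.
have [C2 C20 HC2] := harmonic_le_powR _ _ e2.
have C10 : 0 <= C1 by exact: le_trans ler01 C11.
have r0 : 0 < (r%:R : R) by rewrite ltr0n.
exists (r%:R * C1 * C2 * (K * 4) * 2 `^ eps).
  by rewrite !mulr_ge0 ?powR_ge0 // ltW.
move=> D D' h delta x f hf D0 DD' h0 hd x1.
have x0 : 0 < x by exact: lt_le_trans ltr01 x1.
have Dr0 : 0 < (D%:R : R) by rewrite ltr0n.
have Dr1 : 1 <= (D%:R : R) by rewrite ler1n.
have hr0 : 0 < (h%:R : R) by rewrite ltr0n.
have hr1 : 1 <= (h%:R : R) by rewrite ler1n.
have hk1 : 1 <= (h%:R : R) `^ k by apply: powR_ge1.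
pose z := h%:R * x.
have z0 : 0 < z by apply: mulr_gt0.
pose y : R := D%:R `^ r%:R^-1.
have y1 : 1 <= y by apply: powR_ge1 => //; rewrite invr_ge0.
pose Y := Num.truncn y.
have Y0 : (0 < Y)%N by rewrite truncn_gt0.
have yY : y <= Y.+1%:R by apply: ltW; exact: truncnS_gt.
have YD : (1 * Y ^ r <= D)%N.
  rewrite mul1n -(ler_nat R) natrX.
  have -> : D%:R = y ^+ r :> R.
    by rewrite /y -powR_mulrn ?powR_ge0 // -powRrM mulVf ?gt_eqF // powRr1.
  by apply: lerXn2r; rewrite ?nnegrE ?truncn_le ?powR_ge0.
pose g n : R := f (2 * pi * (z / (n%:R + delta))).
pose beta M : R := K * ((z / D%:R) `^ k * (2 * D%:R / M%:R) `^ (l - k)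
            + 4 * D%:R ^+ 2 / (M%:R * z)).
have Hb M : (0 < M)%N ->
    `|\sum_(1 <= n < D'.+1 | (D < M * n <= D')%N && (Y < n)%N) g (M * n)%N|
      <= beta M.
  by move=> M0; apply: HK.
have := tau_dissection _ _ _ _ _ _ Hb r 1%N r1 isT YD.
have -> : \sum_(1 <= d < D'.+1 | (D < 1 * d <= D')%N) (tau r d)%:R * g (1 * d)%N
   = \sum_(D.+1 <= d < D'.+1)
        (tau r d)%:R * f (2 * pi * (h%:R * (x / (d%:R + delta)))).
  rewrite [RHS](big_nat_widenl _ 1) //= big_nat_cond [RHS]big_nat_cond.
  apply: eq_big => [d|d _]; last by rewrite /g /z mul1n !mulrA.
  by rewrite mul1n ltnS; case: (D < d)%N; case: (d <= D')%N; rewrite ?andbF ?andbT.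
move/le_trans; apply.
set P := x `^ k * _ + _.
have P0 : 0 <= P.
  by apply: addr_ge0; [rewrite mulr_ge0 ?powR_ge0|rewrite divr_ge0 ?exprn_ge0 // ltW].
pose B := (C1 * (2 * D%:R) `^ (eps / 2)) * (K * 4 * h%:R `^ k * P).
have B0 : 0 <= B by rewrite !mulr_ge0 ?powR_ge0.
have D2 : (D'%:R : R) <= 2 * D%:R by rewrite -natrM ler_nat.
apply: (le_trans (y := r%:R * (B * (C2 * (2 * D%:R) `^ (eps / 2))))); last first.
  rewrite le_eqVlt; apply/orP; left; apply/eqP.
  have -> : (2 : R) `^ eps = 2 `^ (eps / 2) * 2 `^ (eps / 2).
    by rewrite -powRD_gt0 // -splitr.
  have -> : D%:R `^ eps = D%:R `^ (eps / 2) * D%:R `^ (eps / 2) :> R.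
    by rewrite -powRD_gt0 // -splitr.
  by rewrite /B powRM //; ring.
rewrite ler_pM2l //.
apply: (le_trans (y := B * \sum_(1 <= m < D'.+1) m%:R^-1)); last first.
  apply: ler_wpM2l => //; have [->|D'0] := posnP D'.
    by rewrite big_nil mulr_ge0 ?powR_ge0.
  apply: (le_trans (HC2 _ D'0)); apply: ler_wpM2l => //.
  by apply: ge0_powR_le => //; exact: ltW.
rewrite mulr_sumr big_mkcond !big_nat; apply: ler_sum => m /andP[m0 mD'].
have mr0 : 0 < (m%:R : R) by rewrite ltr0n.
case: ifP => hm; last by rewrite mulr_ge0 // invr_ge0.
rewrite mul1n /B -[leRHS]mulrA; apply: ler_pM => //.
- exact: le_trans (normr_ge0 _) (Hb m m0).
- apply: (le_trans (HC1 m m0)); apply: ler_wpM2l => //.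
  apply: ge0_powR_le => //; first exact: ltW.
  by apply: le_trans D2; rewrite ler_nat.
have hmy : m%:R * y <= 2 * D%:R.
  apply: le_trans D2; apply: (le_trans (y := (m * Y.+1)%:R)).
    by rewrite natrM ler_pM2l.
  by rewrite ler_nat; rewrite mul1n in hm.
have y0 : 0 < y by exact: lt_le_trans ltr01 y1.
pose Z := 2 * D%:R / y.
(* Z bounds the product m of the short factors; the loss is largest at m = Z. *)
have Zm : 1 <= Z / m%:R by rewrite ler_pdivlMr // mul1r ler_pdivlMr.
have a0 : 0 <= l - k by rewrite subr_ge0; apply: le_trans k1 l0.
have h1 : (2 * D%:R / m%:R) `^ (l - k) <= 2 * D%:R / y / m%:R * y `^ (l - k).
  have -> : 2 * D%:R / m%:R = (Z / m%:R) * y.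
    by rewrite /Z; field; rewrite !gt_eqF.
  rewrite powRM //; [|by lra|exact: ltW].
  by apply: ler_wpM2r; [exact: powR_ge0|apply: ler1_powR => //; lra].
have h2 : (z / D%:R) `^ k = h%:R `^ k * x `^ k / D%:R `^ k.
  rewrite powRM ?invr_ge0 //; last exact: ltW.
  by rewrite powRM // ?(ltW x0) // -powR_inv1 // -powRrM mulN1r powRN.
have h3 : 2 * D%:R / y * y `^ (l - k) / D%:R `^ k
    = 2 * D%:R `^ (1 - k - (1 - (l - k)) / r%:R).
  have -> : 1 - k - (1 - (l - k)) / r%:R = 1 + (- r%:R^-1) + (r%:R^-1 * (l - k)) + (- k).
    by field; rewrite gt_eqF.
  rewrite (powRD_gt0 _ D%:R _ (- k)) // (powRD_gt0 _ _ (1 + - r%:R^-1)) //.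
  rewrite (powRD_gt0 _ _ 1) // powRr1 // !powRN powRrM -/y; ring.
have h4 : 4 * D%:R ^+ 2 / (m%:R * z) <= 4 * (D%:R ^+ 2 / x) * h%:R `^ k / m%:R.
  have -> : 4 * D%:R ^+ 2 / (m%:R * z) = 4 * (D%:R ^+ 2 / x) * h%:R^-1 / m%:R.
    by rewrite /z; field; rewrite !gt_eqF.
  rewrite ler_pM2r ?invr_gt0 //; apply: ler_wpM2l.
    by rewrite mulr_ge0 // divr_ge0 ?exprn_ge0 // ltW.
  by apply: le_trans hk1; rewrite invf_le1.
have -> : K * 4 * h%:R `^ k * P / m%:R = K * (4 * (h%:R `^ k * (P / m%:R))) by ring.
rewrite /beta; apply: ler_wpM2l => //.
apply: (le_trans (y := 2 * (h%:R `^ k * x `^ k * D%:R `^ (1 - k - (1 - (l - k)) / r%:R) / m%:R)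
   + 4 * (D%:R ^+ 2 / x) * h%:R `^ k / m%:R)).
  apply: lerD => //.
  rewrite h2; apply: (le_trans (ler_wpM2l _ h1)).
    by rewrite divr_ge0 ?mulr_ge0 ?powR_ge0.
  rewrite le_eqVlt; apply/orP; left; apply/eqP.
  transitivity (h%:R `^ k * x `^ k / m%:R * (2 * D%:R / y * y `^ (l - k) / D%:R `^ k)).
    by ring.
  by rewrite h3; ring.
have t0 : 0 <= h%:R `^ k * x `^ k * D%:R `^ (1 - k - (1 - (l - k)) / r%:R) / m%:R.
  by rewrite divr_ge0 ?mulr_ge0 ?powR_ge0.
have -> : 4 * (h%:R `^ k * (P / m%:R)) =
   4 * (h%:R `^ k * x `^ k * D%:R `^ (1 - k - (1 - (l - k)) / r%:R) / m%:R)
   + 4 * (D%:R ^+ 2 / x) * h%:R `^ k / m%:R by rewrite /P; ring.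
lra.
Qed.

(** * The sawtooth sum over a dyadic block *)

Definition theta (R : realType) (r : nat) (k l : R) : R :=
  (k * (r%:R - 1) + l + r%:R - 1) / (k * (r%:R - 1) + l + 2 * r%:R - 1).

(** At the top of the range, [D = x ^ (1 - theta)], and with [H = x ^ (1 - 2 theta)]
    frequencies, the truncation error [D / H] and the contribution
    [(H x) ^ k D ^ (1 - k - (1 - l + k) / r)] of the exponential sums are both equal to
    [x ^ theta]: the third item is the equation that determines [theta]. *)
Lemma theta_facts (R : realType) (r : nat) (k l : R) : (2 <= r)%N ->
  0 <= k <= 1 / 2 -> 1 / 2 <= l <= 1 -> k * (r%:R - 1) < 1 - l ->
  let t := theta R r k l in let e1 := 1 - k - (1 - (l - k)) / r%:R in
  [/\ 0 < t < 1 / 2, 0 <= e1, k + (1 - t) * e1 + (1 - 2 * t) * k = t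
    & (1 - 2 * t) * (1 + k) <= t].
Proof.
move=> r2 /andP[k0 k1] /andP[l0 l1] kl t e1.
have n2 : 2 <= (r%:R : R) by rewrite (ler_nat R 2).
pose n : R := r%:R; pose kap := k * (n - 1) + l.
have kn : 0 <= k * (n - 1) by apply: mulr_ge0; rewrite // /n; lra.
have kap1 : kap < 1 by rewrite /kap /n; lra.
have kap0 : 1 / 2 <= kap by rewrite /kap; lra.
pose s := kap + 2 * n - 1.
have s0 : 0 < s by rewrite /s /n; lra.
have tE : t = (kap + n - 1) / s by [].
have t2 : 1 - 2 * t = (1 - kap) / s by rewrite tE /s; field; rewrite gt_eqF.
have n0 : 0 < n by rewrite /n; lra.
split.
- rewrite tE divr_gt0 //=; last by rewrite /n; lra.
  by rewrite ltr_pdivrMr // /s /n; lra.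
- rewrite /e1 -/n subr_ge0 ler_pdivrMr //; rewrite -/n in n2; nra.
- have tm : 1 - t = n / s by rewrite tE /s; field; rewrite gt_eqF.
  rewrite t2 tm tE /e1 -/n /s /kap; field.
  by rewrite gt_eqF //= gt_eqF.
- rewrite t2 tE mulrAC ler_pM2r ?invr_gt0 //.
  have : (1 - kap) * (1 + k) <= 1 / 2 * (3 / 2) by apply: ler_pM; lra.
  by rewrite -/n in n2; lra.
Qed.

(** Both terms of the exponential sum bound increase with [D], hence may be evaluated at
    [D = x ^ (1 - t)]. There, with the factor [H ^ k], the first one is [x ^ t] and the second one is at
    most that. *)
Lemma power_balance (R : realType) (t k e1 eps x D H : R) :
  0 <= k <= 1 -> t <= 1 / 2 -> 0 <= t -> 0 <= e1 -> k + (1 - t) * e1 + (1 - 2 * t) * k = t ->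
  (1 - 2 * t) * (1 + k) <= t -> 0 <= eps -> 1 <= x ->
  0 <= D <= x `^ (1 - t) -> 0 <= H <= 3 * x `^ (1 - 2 * t) ->
  D `^ eps * (x `^ k * D `^ e1 + D ^+ 2 / x) * H `^ k <= 6 * x `^ (t + eps).
Proof.
move=> /andP[k0 k1] t1 t0 e10 tE tle e0 x1 /andP[D0 Dx] /andP[H0 Hx].
have x0 : 0 < x by exact: lt_le_trans ltr01 x1.
have De : D `^ eps <= x `^ eps.
  apply: ge0_powR_le => //; apply: (le_trans Dx); apply: ler1_powR; lra.
set P := _ + _.
have P0 : 0 <= P.
  by apply: addr_ge0; [rewrite mulr_ge0 ?powR_ge0|rewrite divr_ge0 ?exprn_ge0 // ltW].
have PE : P <= x `^ (k + (1 - t) * e1) + x `^ (1 - 2 * t).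
  apply: lerD.
    rewrite (powRD_gt0 _ _ k) // powRrM; apply: ler_wpM2l; first exact: powR_ge0.
    exact: ge0_powR_le.
  rewrite ler_pdivrMr //.
  have -> : x `^ (1 - 2 * t) * x = (x `^ (1 - t)) ^+ 2.
    transitivity (x `^ (1 - 2 * t + 1)); first by rewrite (powRD_gt0 _ _ _ 1) // powRr1 // ltW.
    by rewrite expr2 -powRD_gt0 //; congr (_ `^ _); ring.
  by apply: lerXn2r; rewrite ?nnegrE ?powR_ge0.
have HkE : H `^ k <= 3 * x `^ ((1 - 2 * t) * k).
  apply: (le_trans (y := (3 * x `^ (1 - 2 * t)) `^ k)); first exact: ge0_powR_le.
  rewrite powRM ?powR_ge0 // powRrM; apply: ler_wpM2r; first exact: powR_ge0.
  by apply: ler1_powR; lra.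
have PH : P * H `^ k <= 6 * x `^ t.
  apply: (le_trans (ler_pM P0 (powR_ge0 _ _) PE HkE)).
  have -> : (x `^ (k + (1 - t) * e1) + x `^ (1 - 2 * t)) * (3 * x `^ ((1 - 2 * t) * k))
     = 3 * (x `^ (k + (1 - t) * e1) * x `^ ((1 - 2 * t) * k)
            + x `^ (1 - 2 * t) * x `^ ((1 - 2 * t) * k)) by ring.
  rewrite -!powRD_gt0 // tE.
  have : x `^ (1 - 2 * t + (1 - 2 * t) * k) <= x `^ t.
    by apply: ler_powR => //; lra.
  lra.
have -> : 6 * x `^ (t + eps) = x `^ eps * (6 * x `^ t) by rewrite powRD_gt0 //; ring.
rewrite -mulrA; apply: (ler_pM (powR_ge0 _ _) _ De PH).
by apply: mulr_ge0 => //; exact: powR_ge0.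
Qed.

Lemma odd_nat_approx (R : realType) (u : R) : 1 <= u ->
  exists2 n, odd n & u <= n%:R <= 3 * u.
Proof.
move=> u1; exists (Num.truncn u).*2.+1; first by rewrite /= odd_double.
have u0 : 0 <= u by lra.
have /andP[h1 h2] := truncn_itv u0.
by move: h1 h2; rewrite -!natr1 -muln2 natrM => h1 h2; apply/andP; split; lra.
Qed.

Lemma sum_tau_le (R : realType) (r D D' : nat) (C eps x : R) : 0 <= eps ->
  (forall n, (0 < n)%N -> (tau r n)%:R <= C * n%:R `^ eps) -> 0 <= C -> D'%:R <= x ->
  \sum_(D.+1 <= d < D'.+1) ((tau r d)%:R : R) <= D'%:R * (C * x `^ eps).
Proof.
move=> e0 HC C0 Dx.
apply: (le_trans (y := \sum_(D.+1 <= d < D'.+1) C * x `^ eps)).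
  rewrite !big_nat; apply: ler_sum => d /andP[d0 dD].
  apply: (le_trans (HC _ (leq_trans (ltn0Sn D) d0))); apply: ler_wpM2l => //.
  apply: ge0_powR_le => //; apply: le_trans Dx.
  by rewrite ler_nat.
rewrite sumr_const_nat -[leLHS]mulr_natl; apply: ler_wpM2r.
  by rewrite mulr_ge0 ?powR_ge0.
by rewrite ler_nat subSS leq_subr.
Qed.

(** The number of windows is [H], about [x ^ (1 - 2 theta)], and the grid has [M = a * H]
    points with [a] about [x], fine enough for the discretization error to be
    negligible; [a] and [H] are odd because the discrete Fourier expansion is the one
    for odd [M]. *)
Lemma tau_sawtooth_block (R : realType) (r : nat) (k l eps : R) : (2 <= r)%N ->
  exponent_pair k l -> k * (r%:R - 1) < 1 - l -> 0 < eps ->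
  exists2 C : R, 0 <= C & forall (D D' : nat) (delta x : R),
    (0 < D)%N -> (D <= D')%N -> (D' <= 2 * D)%N -> 0 <= delta <= 1 -> 1 <= x ->
    D'%:R <= x `^ (1 - theta R r k l) ->
    `|\sum_(D.+1 <= d < D'.+1) (tau r d)%:R *
        (x / (d%:R + delta) - (Num.truncn (x / (d%:R + delta)))%:R - 1 / 2)|
    <= C * x `^ (theta R r k l + eps).
Proof.
move=> r2 ep kl e0; have [k0 k1 l0 l1 _] := ep.
have r1 : (1 <= r)%N by apply: ltnW.
have k01 : 0 <= k <= 1 / 2 by rewrite k0.
have l01 : 1 / 2 <= l <= 1 by rewrite l0.
have [] := theta_facts R r k l r2 k01 l01 kl.
set t := theta R r k l; set e1 := _ - _ - _ => /andP[t0 t1] e10 tE tle.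
have e2 : 0 < eps / 2 by lra.
have e4 : 0 < eps / 4 by lra.
have t2 : t <= 1 / 2 by exact: ltW.
have t3 : 0 <= 1 - 2 * t by lra.
have t4 : 1 - t <= 1 by lra.
have t5 : 1 - 2 * t <= 1 by lra.
have t6 : 1 - t + eps / 2 <= t + eps / 2 + 1 by lra.
have t7 : 1 - t + eps / 2 <= t + eps / 2 + (1 - 2 * t) by lra.
have kle1 : 0 <= k <= 1 by rewrite k0 /=; lra.
have [C0 C00 HC0] := tau_exp_sum R r k l _ r1 ep e2.
have [C1 C11 HC1] := tau_bound R r _ r1 e2.
have [C2 C20 HC2] := harmonic_le_powR R _ e4.
have C10 : 0 <= C1 by exact: le_trans ler01 C11.
pose Lh := C2 * 9 `^ (eps / 4).
have Lh0 : 0 <= Lh by rewrite mulr_ge0 ?powR_ge0.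
exists ((48 * C0 + 16 * C1) * Lh + 2 * C1).
  by rewrite addr_ge0 ?mulr_ge0 // addr_ge0 ?mulr_ge0.
move=> D D' delta x D0 DD' D2D hd x1 D'x.
have x0 : 0 < x by exact: lt_le_trans ltr01 x1.
have xX c : x `^ c * x = x `^ (c + 1) by rewrite powRD_gt0 // powRr1 // ltW.
have Dx : D%:R <= x `^ (1 - t) by apply: le_trans D'x; rewrite ler_nat.
have xx : x `^ (1 - t) <= x by exact: ler1_powR.
have D'xx : D'%:R <= x by apply: le_trans D'x xx.
pose u := x `^ (1 - 2 * t).
have u1 : 1 <= u by exact: powR_ge1.
have [H oH /andP[Hu Hu3]] := odd_nat_approx R u u1.
have [a oa /andP[ax ax3]] := odd_nat_approx R x x1.
have Hr0 : 0 < (H%:R : R) by rewrite ltr0n odd_gt0.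
have ar0 : 0 < (a%:R : R) by rewrite ltr0n odd_gt0.
pose P := x `^ k * D%:R `^ e1 + D%:R ^+ 2 / x.
pose E := C0 * D%:R `^ (eps / 2) * P.
have P0 : 0 <= P.
  by apply: addr_ge0; [rewrite mulr_ge0 ?powR_ge0|rewrite divr_ge0 ?exprn_ge0 // ltW].
pose w d : R := (tau r d)%:R.
pose y d : R := x / (d%:R + delta).
have w0 d : d \in index_iota D.+1 D'.+1 -> 0 <= w d by [].
have y0 d : d \in index_iota D.+1 D'.+1 -> 0 <= y d.
  case/andP: hd => d0 _ _; apply: divr_ge0; first exact: ltW.
  exact: addr_ge0.
have Hcos h : (0 < h)%N ->
    `|\sum_(d <- index_iota D.+1 D'.+1) w d * cos (2 * pi * (h%:R * y d))| <= E * h%:R `^ k.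
  by move=> h0; apply: HC0 => //; left.
have Hsin h : (0 < h)%N ->
    `|\sum_(d <- index_iota D.+1 D'.+1) w d * sin (2 * pi * (h%:R * y d))| <= E * h%:R `^ k.
  by move=> h0; apply: HC0 => //; right.
have := sawtooth_sum R _ w y k E a H (a * H) kle1 oa oH erefl w0 y0 Hcos Hsin.
move/le_trans; apply.
set W := \sum_(d <- _) w d; set harm := \sum_(1 <= h < _) _.
have W0 : 0 <= W by rewrite sumr_ge0.
have WE : W <= C1 * x `^ (1 - t + eps / 2).
  apply: (le_trans (sum_tau_le _ _ _ _ _ _ x (ltW e2) HC1 C10 D'xx)).
  rewrite powRD_gt0 // mulrCA; apply: ler_wpM2l => //.
  by apply: ler_wpM2r => //; exact: powR_ge0.
have harmE : harm <= Lh * x `^ (eps / 2).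
  have aH0 : (0 < a * H)%N by rewrite muln_gt0 !odd_gt0.
  apply: (le_trans (HC2 _ aH0)); rewrite /Lh -mulrA; apply: ler_wpM2l => //.
  have -> : x `^ (eps / 2) = (x ^+ 2) `^ (eps / 4).
    by rewrite -powR_mulrn ?(ltW x0) // -powRrM; congr (_ `^ _); field.
  rewrite -powRM ?exprn_ge0 ?(ltW x0) //; apply: ge0_powR_le => //; first exact: ltW.
  have ux : u <= x by exact: ler1_powR.
  have -> : 9 * x ^+ 2 = (3 * x) * (3 * x) by ring.
  rewrite natrM; apply: ler_pM => //; apply: (le_trans Hu3).
  by rewrite ler_pM2l.
have harm0 : 0 <= harm by rewrite sumr_ge0 // => h _; rewrite invr_ge0.
have EH : E * H%:R `^ k <= 6 * C0 * x `^ (t + eps / 2).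
  have -> : E * H%:R `^ k = C0 * (D%:R `^ (eps / 2) * P * H%:R `^ k) by rewrite /E; ring.
  rewrite [6 * C0]mulrC -[leRHS]mulrA; apply: ler_wpM2l => //.
  have hD : 0 <= (D%:R : R) <= x `^ (1 - t) by rewrite ler0n.
  have hH : 0 <= (H%:R : R) <= 3 * x `^ (1 - 2 * t) by rewrite ler0n.
  exact: (power_balance _ _ _ _ _ _ _ _ kle1 (ltW t1) (ltW t0) e10 tE tle (ltW e2) x1 hD hH).
have WM : W * H%:R / (a * H)%:R <= C1 * x `^ (t + eps / 2).
  have -> : W * H%:R / (a * H)%:R = W / a%:R by rewrite natrM; field; rewrite !gt_eqF.
  rewrite ler_pdivrMr //; apply: (le_trans WE); rewrite -mulrA; apply: ler_wpM2l => //.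
  apply: (le_trans (y := x `^ (t + eps / 2) * x)); last first.
    by apply: ler_wpM2l => //; exact: powR_ge0.
  by rewrite xX; apply: ler_powR.
have WH : 2 * W / H%:R <= 2 * C1 * x `^ (t + eps / 2).
  rewrite ler_pdivrMr //; apply: (le_trans (y := 2 * (C1 * x `^ (1 - t + eps / 2)))).
    by rewrite ler_pM2l.
  rewrite -!mulrA ler_pM2l //; apply: ler_wpM2l => //.
  apply: (le_trans (y := x `^ (t + eps / 2) * u)); last first.
    by apply: ler_wpM2l => //; exact: powR_ge0.
  by rewrite -powRD_gt0 //; apply: ler_powR.
have -> : x `^ (t + eps) = x `^ (t + eps / 2) * x `^ (eps / 2).
  by rewrite -powRD_gt0 // -addrA -splitr.
set X := x `^ (t + eps / 2) in EH WM WH *.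
have X0 : 0 <= X by exact: powR_ge0.
have xe1 : 1 <= x `^ (eps / 2) by apply: powR_ge1 => //; exact: ltW.
have E0 : 0 <= E by rewrite !mulr_ge0 ?powR_ge0.
rewrite -[8 * E * _]mulrA -[16 * W * _]mulrA -[16 * (W * _) / _]mulrA [leRHS]mulrDl; apply: lerD; last first.
  apply: (le_trans WH); apply: ler_wpM2l; first by rewrite mulr_ge0.
  by rewrite ler_peMr.
have -> : (48 * C0 + 16 * C1) * Lh * (X * x `^ (eps / 2))
  = ((48 * C0 + 16 * C1) * X) * (Lh * x `^ (eps / 2)) by ring.
have WM0 : 0 <= W * H%:R / (a * H)%:R by apply: divr_ge0 => //; exact: mulr_ge0.
have EH0 : 0 <= E * H%:R `^ k by apply: mulr_ge0 => //; exact: powR_ge0.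
move: (E * H%:R `^ k) (W * H%:R / (a * H)%:R) EH WM EH0 WM0 => v1 v2 EH WM EH0 WM0.
apply: ler_pM => //; first by rewrite addr_ge0 // mulr_ge0.
have -> : (48 * C0 + 16 * C1) * X = 8 * (6 * C0 * X) + 16 * (C1 * X) by ring.
by apply: lerD; rewrite ler_pM2l.
Qed.

(** * The asymptotic formula *)

Lemma uphalf_dyadic n i : (1 < n)%N -> (n <= 2 ^ i.+1)%N ->
  [/\ 0 < uphalf n, uphalf n <= n, n <= 2 * uphalf n & uphalf n <= 2 ^ i]%N.
Proof. by move=> n1; rewrite expnS => ni; split; lia. Qed.

Lemma natr_log2_le (R : realType) (eps x : R) (t : nat) : 0 < eps -> 1 <= x ->
  2 ^+ t <= x -> t%:R + 2 <= ((eps * ln 2)^-1 + 2) * x `^ eps.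
Proof.
move=> e0 x1 tx.
have l2 : 0 < ln (2 : R) by apply: ln_gt0; lra.
have el2 : 0 < eps * ln (2 : R) by apply: mulr_gt0.
have xe : 1 <= x `^ eps by apply: powR_ge1 => //; exact: ltW.
rewrite mulrDl; apply: lerD; last by rewrite ler_peMr.
rewrite mulrC ler_pdivlMr //.
apply: (le_trans (y := (2 ^+ t) `^ eps)); last first.
  by apply: ge0_powR_le => //; exact: ltW.
rewrite -powR_mulrn // -powRrM /powR ifF; last by apply/negbTE; rewrite pnatr_eq0.
apply: (le_trans _ (expR_ge1Dx _)); lra.
Qed.

Lemma tau_sawtooth_sum (R : realType) (r : nat) (k l eps : R) : (2 <= r)%N ->
  exponent_pair k l -> k * (r%:R - 1) < 1 - l -> 0 < eps ->
  exists2 C : R, 0 <= C & forall (N : nat) (delta x : R),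
    0 <= delta <= 1 -> 1 <= x -> N%:R <= x `^ (1 - theta R r k l) ->
    `|\sum_(1 <= d < N.+1) (tau r d)%:R *
        (x / (d%:R + delta) - (Num.truncn (x / (d%:R + delta)))%:R - 1 / 2)|
    <= C * x `^ (theta R r k l + eps).
Proof.
move=> r2 ep kl e0; have [k0 k1 l0 l1 _] := ep.
have k01 : 0 <= k <= 1 / 2 by rewrite k0.
have l01 : 1 / 2 <= l <= 1 by rewrite l0.
have [] := theta_facts R r k l r2 k01 l01 kl => /andP[t0 t1] _ _ _.
have e2 : 0 < eps / 2 by lra.
have [C C0 HC] := tau_sawtooth_block R r k l _ r2 ep kl e2.
have [C1 C11 HC1] := tau_bound R r _ (ltnW r2) e2.
set t := theta R r k l in t0 t1 HC *.
pose L := (eps / 2 * ln (2 : R))^-1 + 2.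
have LC0 : 0 <= L * (C + C1).
  have l2 : 0 <= ln (2 : R) by apply: ln_ge0; lra.
  apply: mulr_ge0; last by lra.
  by rewrite addr_ge0 // invr_ge0 mulr_ge0 // ltW.
exists (L * (C + C1)) => //.
move=> N delta x hd x1 Nx.
have x0 : 0 < x by exact: lt_le_trans ltr01 x1.
have X1 : 1 <= x `^ (t + eps / 2) by apply: powR_ge1 => //; lra.
pose B := (C + C1) * x `^ (t + eps / 2).
have B0 : 0 <= B by rewrite mulr_ge0 ?powR_ge0 ?addr_ge0 //; lra.
pose T n := \sum_(1 <= d < n.+1) (tau r d)%:R *
        (x / (d%:R + delta) - (Num.truncn (x / (d%:R + delta)))%:R - 1 / 2).
have main i n : (n <= 2 ^ i)%N -> (n <= N)%N -> `|T n| <= i.+1%:R * B.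
  elim: i n => [|i IH] n ni nN.
    rewrite mul1r /T; case: n ni nN => [|[|//]] _ _.
      by rewrite big_nil normr0.
    rewrite big_nat1 normrM.
    apply: (le_trans (y := C1 * 1)); last first.
      by apply: ler_pM => //; rewrite ?lerDr //; lra.
    apply: ler_pM => //.
      by have := HC1 1%N isT; rewrite powR1 mulr1 ger0_norm.
    case/andP: hd => d0 _.
    have y0 : 0 <= x / (1%:R + delta) by apply: divr_ge0; [exact: ltW|exact: addr_ge0].
    have /andP[h1 h2] := truncn_itv y0.
    by rewrite ler_norml; move: h2; rewrite -[(Num.truncn _).+1%:R]natr1 => h2; apply/andP; split; lra.
  have [n1|n1] := leqP n 1.
    apply: (le_trans (IH n _ nN)); first by apply: leq_trans n1 _; rewrite expn_gt0.
    by apply: ler_wpM2r => //; rewrite ler_nat.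
  have := uphalf_dyadic n i n1 ni; set m := uphalf n => -[m0 mn m2 mi].
  have -> : T n = T m + \sum_(m.+1 <= d < n.+1) (tau r d)%:R *
        (x / (d%:R + delta) - (Num.truncn (x / (d%:R + delta)))%:R - 1 / 2).
    by rewrite /T (big_cat_nat (n := m.+1)).
  apply: (le_trans (ler_normD _ _)).
  have -> : i.+2%:R * B = i.+1%:R * B + B by rewrite -[i.+2%:R]natr1 mulrDl mul1r.
  apply: lerD; first by apply: IH => //; exact: leq_trans mn nN.
  apply: (le_trans (HC m n delta x m0 mn m2 hd x1 _)).
    by apply: le_trans Nx; rewrite ler_nat.
  rewrite /B mulrDl lerDl mulr_ge0 ?powR_ge0 //; lra.
have [N0|N0] := posnP N.
  by rewrite N0 big_nil normr0 mulr_ge0 ?powR_ge0.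
have lt := trunc_log_ltn N (isT : (1 < 2)%N).
have := main _ _ (ltnW lt) (leqnn N); rewrite /T => /le_trans; apply.
have -> : L * (C + C1) * x `^ (t + eps) = (L * x `^ (eps / 2)) * B.
  by rewrite /B {1}(splitr eps) addrA [in LHS]powRD_gt0 //; ring.
apply: ler_wpM2r => //.
rewrite -natr1 -natr1 -addrA; apply: natr_log2_le => //.
apply: (le_trans (y := N%:R)); first by rewrite -natrX ler_nat trunc_logP.
by apply: (le_trans Nx); apply: ler1_powR; lra.
Qed.

Local Open Scope classical_set_scope.
Local Open Scope ring_scope.

Theorem theorem1p2 (R : realType) (r : nat) (k l : R) :
  (2 <= r)%N -> exponent_pair k l -> 1 - l > k * (r%:R - 1) ->
  exists S : R,
    (\sum_(1 <= n < N.+1) (tau r n)%:R / (n%:R * (n%:R + 1)) @[N --> \oo] --> S)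
    /\ forall eps : R, 0 < eps ->
       exists K x0 : R, forall x : R, x0 <= x ->
         `| \sum_(1 <= n < (Num.truncn x).+1)
              (tau r (Num.truncn (x / n%:R)))%:R - x * S |
         <= K * x `^ ((k * (r%:R - 1) + l + r%:R - 1)
                      / (k * (r%:R - 1) + l + 2 * r%:R - 1) + eps).
Proof.
move=> r2 ep kl; have [k0 k1 l0 l1 _] := ep.
have k01 : 0 <= k <= 1 / 2 by rewrite k0.
have l01 : 1 / 2 <= l <= 1 by rewrite l0.
have [] := theta_facts R r k l r2 k01 l01 kl => /andP[t0 t1] _ _ _.
have r1 : (1 <= r)%N by apply: ltnW.
pose f n : R := (tau r n)%:R.
have f0 n : 0 <= f n by [].
have q0 : 0 < (1 / 4 : R) <= 1 / 4 by apply/andP; split; lra.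
have [q1 _] := andP q0.
have [Cq _ HCq] := tau_bound R r _ r1 q1.
have [S HS _] := series_tail R f Cq _ q0 f0 HCq.
exists S; split; first exact: HS.
move=> eps0 eps00; rewrite -/(theta R r k l); set t := theta R r k l in t0 t1 *.
pose eps := Num.min eps0 (1 / 4).
have e0 : 0 < eps by rewrite lt_min eps00.
have e1 : 0 <= 1 - eps by rewrite subr_ge0 ge_min; apply/orP; right; lra.
have ee0 : eps <= eps0 by rewrite ge_min lexx.
have he : 0 < eps <= 1 / 4 by rewrite e0 ge_min lexx orbT.
have [C1 C11 HC1] := tau_bound R r _ r1 e0.
have [S' HS' tail] := series_tail R f C1 _ he f0 HC1.
have SS : S' = S by apply: (cvg_unique _ HS' HS).
rewrite {S' HS'}SS in tail.
have [C C0 HC] := tau_sawtooth_sum R r k l _ r2 ep kl e0.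
rewrite -/t in HC.
have C10 : 0 <= C1 by exact: le_trans ler01 C11.
exists (C1 + 2 * C1 + C + C), 1 => x x1.
have x0 : 0 < x by exact: lt_le_trans ltr01 x1.
have xn : 0 <= x by exact: ltW.
pose u := x `^ (1 - t).
have u1 : 1 <= u by apply: powR_ge1 => //; lra.
pose Q := Num.truncn u.
have /andP[Qu uQ] : Q%:R <= u < Q.+1%:R by apply: truncn_itv; lra.
have u0 : 0 < u by exact: lt_le_trans ltr01 u1.
have xu : x / u = x `^ t.
  have xE : x = x `^ t * u by rewrite -powRD_gt0 // addrCA subrr addr0 powRr1.
  by rewrite {1}xE mulfK // gt_eqF.
set X := x `^ (t + eps).
have XE : x `^ t * x `^ eps = X by rewrite -powRD_gt0.
have CC0 : 0 <= C1 + 2 * C1 + C + C by rewrite !addr_ge0 // mulr_ge0.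
apply: (le_trans (y := (C1 + 2 * C1 + C + C) * X)); last first.
  by apply: ler_wpM2l; [exact: CC0|apply: ler_powR => //; rewrite lerD2l].
rewrite (sum_floor_quotients R f x Q xn).
pose y (delta : R) (d : nat) := x / (d%:R + delta).
pose T (delta : R) := \sum_(1 <= d < Q.+1) (tau r d)%:R *
        (y delta d - (Num.truncn (y delta d))%:R - 1 / 2).
have T0 : `|T 0| <= C * X by apply: HC => //; rewrite lexx ler01.
have T1 : `|T 1| <= C * X by apply: HC => //; rewrite lexx ler01.
have -> : \sum_(1 <= d < Q.+1)
     f d * ((Num.truncn (x / d%:R))%:R - (Num.truncn (x / d.+1%:R))%:R)
   = x * (\sum_(1 <= d < Q.+1) f d / (d%:R * (d%:R + 1))) - T 0 + T 1.
  rewrite mulr_sumr /T -sumrB -big_split /=; apply: eq_big_nat => d /andP[d0 _].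
  have dr0 : (d%:R : R) != 0 by rewrite pnatr_eq0 -lt0n.
  have dr1 : (d%:R + 1 : R) != 0 by rewrite natr1 pnatr_eq0.
  rewrite /y addr0 natr1 -/(f d).
  have E : x * (f d / (d%:R * d.+1%:R)) = f d * (x / d%:R - x / d.+1%:R).
    by rewrite -natr1; field; rewrite dr0 dr1.
  by rewrite E; ring.
set A := \sum_(1 <= n < _) f _; set p := \sum_(1 <= d < Q.+1) _.
have A0 : 0 <= A by rewrite sumr_ge0.
have AX : A <= C1 * X.
  apply: (le_trans (y := \sum_(1 <= n < (Num.truncn (x / Q.+1%:R)).+1) C1 * x `^ eps)).
    rewrite /A !big_nat; apply: ler_sum => n /andP[n0 nx].
    have nr0 : 0 < (n%:R : R) by rewrite ltr0n.
    have nr1 : 1 <= (n%:R : R) by rewrite ler1n.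
    have xn0 : 0 <= x / n%:R by apply: divr_ge0.
    have xnx : x / n%:R <= x by rewrite ler_pdivrMr // ler_peMr.
    have h1 : 1 <= x / n%:R.
      rewrite ler_pdivlMr // mul1r.
      move: nx; rewrite ltnS truncn_ge_nat ?divr_ge0 // => /le_trans; apply.
      by rewrite ler_pdivrMr ?ltr0n // ler_peMr // ler1n.
    apply: (le_trans (HC1 _ _)); first by rewrite truncn_gt0.
    apply: ler_wpM2l => //; apply: ge0_powR_le => //; first exact: ltW.
    by apply: le_trans xnx; rewrite truncn_le.
  rewrite sumr_const_nat subSS subn0 -[leLHS]mulr_natl -XE mulrCA.
  apply: ler_wpM2l => //; apply: ler_wpM2r; first exact: powR_ge0.
  apply: (le_trans (y := x / Q.+1%:R)); first by rewrite truncn_le divr_ge0.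
  by rewrite -xu ler_pM2l // lef_pV2 ?posrE ?ltr0n // ltW.
have /andP[p0 p1] := tail Q.
have pX : x * (S - p) <= 2 * C1 * X.
  apply: (le_trans (ler_wpM2l xn p1)); rewrite mulrCA; apply: ler_wpM2l.
    by rewrite mulr_ge0.
  have -> : (Q.+1%:R : R) `^ (eps - 1) = (Q.+1%:R `^ (1 - eps))^-1.
    by rewrite -powRN; congr (_ `^ _); ring.
  have ule : u `^ (1 - eps) <= Q.+1%:R `^ (1 - eps).
    by apply: ge0_powR_le; [exact: e1|exact: ltW|exact: ltW].
  apply: (le_trans (y := x * (u `^ (1 - eps))^-1)).
    by rewrite ler_pM2l // lef_pV2 ?posrE ?powR_gt0 // ltr0n.
  rewrite -powRN -powRrM -[X in X * _ <= _](powRr1 xn) -powRD_gt0 //.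
  apply: ler_powR => //; rewrite (_ : _ + _ = t + eps * (1 - t)); last by ring.
  by rewrite lerD2l ler_piMr // ?(ltW e0) // gerBl ltW.
have p2 : 0 <= x * (S - p) by apply: mulr_ge0.
have -> : A + (x * p - T 0 + T 1) - x * S = A + (- (x * (S - p))) + - T 0 + T 1 by ring.
have -> : (C1 + 2 * C1 + C + C) * X = C1 * X + 2 * C1 * X + C * X + C * X by ring.
apply: (le_trans (ler_normD _ _)); apply: lerD => //.
apply: (le_trans (ler_normD _ _)); rewrite normrN; apply: lerD => //.
apply: (le_trans (ler_normD _ _)); rewrite normrN; apply: lerD.
  by rewrite ger0_norm.
by rewrite ger0_norm.
Qed.
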